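(* Consider a multi-agent system of $n$ agents described as rigid bodies with poses given by unit dual quaternions $\underline{\boldsymbol{x}}_i=\boldsymbol{r}_i+\varepsilon\frac{1}{2}\boldsymbol{p}_i\boldsymbol{r}_i$. Let the dynamics of each agent be $\operatorname{vec}_{8}\underline{\boldsymbol{u}}_{x,i}\triangleq\operatorname{vec}_{8}\dot{\underline{\boldsymbol{x}}}_{i}$, $i=1,\ldots,n$, and each agent's output be $\underline{\boldsymbol{y}}_{c,i}\triangleq\log(\underline{\boldsymbol{x}}_{c,i})=\log(\underline{\boldsymbol{x}}_{i}\underline{\boldsymbol{\delta}}_{i}^{*})$, where $\underline{\boldsymbol{\delta}}_{i}$ is the constant, locally known desired pose of agent $i$ relative to the center of formation. With the consensus protocol \[ \operatorname{vec}_{8}\underline{\boldsymbol{u}}_{x,i}=-\overset{-}{\boldsymbol{H}}_{8}(\underline{\boldsymbol{\delta}}_{i})\boldsymbol{Q}_{8}(\underline{\boldsymbol{x}}_{c,i})\sum_{j=1}^{n}a_{ij}\operatorname{vec}_{6}\left(\underline{\boldsymbol{y}}_{c,i}-\underline{\boldsymbol{y}}_{c,j}\right), \] the multi-agent system asymptotically achieves formation (i.e., all $\underline{\boldsymbol{x}}_{c,i}$ converge to a common $\underline{\boldsymbol{x}}_c$, so that $\underline{\boldsymbol{x}}_i\to\underline{\boldsymbol{x}}_c\underline{\boldsymbol{\delta}}_i$) if and only if the directed graph $\mathcal{G}$ has a directed spanning tree.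
   Context: Quaternions $\boldsymbol{h}=h_{1}+\hat{\imath}h_{2}+\hat{\jmath}h_{3}+\hat{k}h_{4}$, dual quaternions $\underline{\boldsymbol{h}}=\boldsymbol{h}+\varepsilon\boldsymbol{h}'$ ($\varepsilon^2=0$), conjugate $\underline{\boldsymbol{h}}^*=\mathrm{Re}(\underline{\boldsymbol{h}})-\mathrm{Im}(\underline{\boldsymbol{h}})$; unit dual quaternions $\underline{\boldsymbol{x}}=\boldsymbol{r}+\varepsilon\frac12\boldsymbol{p}\boldsymbol{r}$ with $\boldsymbol{r}=\cos(\phi/2)+\boldsymbol{n}\sin(\phi/2)$, $\phi\in[0,2\pi)$, have $\log\underline{\boldsymbol{x}}=\frac12(\phi\boldsymbol{n}+\varepsilon\boldsymbol{p})$. $\operatorname{vec}_4,\operatorname{vec}_8$ stack coefficients into $\mathbb{R}^4,\mathbb{R}^8$; $\operatorname{vec}_3,\operatorname{vec}_6$ stack imaginary coefficients of pure quaternions/pure dual quaternions. The Hamilton operators satisfy $\operatorname{vec}_8(\underline{\boldsymbol{h}}_1\underline{\boldsymbol{h}}_2)=\overset{+}{\boldsymbol{H}}_8(\underline{\boldsymbol{h}}_1)\operatorname{vec}_8\underline{\boldsymbol{h}}_2=\overset{-}{\boldsymbol{H}}_8(\underline{\boldsymbol{h}}_2)\operatorname{vec}_8\underline{\boldsymbol{h}}_1$, with $\overset{-}{\boldsymbol{H}}_{8}(\underline{\boldsymbol{h}})=\begin{bmatrix}\overset{-}{\boldsymbol{H}}_{4}(\boldsymbol{h}) & \boldsymbol{0}_{4\times4}\\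 \overset{-}{\boldsymbol{H}}_{4}(\boldsymbol{h}') & \overset{-}{\boldsymbol{H}}_{4}(\boldsymbol{h})\end{bmatrix}$, and analogously for $+$, where $\overset{\pm}{\boldsymbol{H}}_4$ are the $4\times4$ quaternion Hamilton operators with $\operatorname{vec}_4(\boldsymbol{h}_1\boldsymbol{h}_2)=\overset{+}{\boldsymbol{H}}_4(\boldsymbol{h}_1)\operatorname{vec}_4\boldsymbol{h}_2=\overset{-}{\boldsymbol{H}}_4(\boldsymbol{h}_2)\operatorname{vec}_4\boldsymbol{h}_1$. For a unit dual quaternion $\underline{\boldsymbol{x}}=\boldsymbol{r}+\varepsilon\frac12\boldsymbol{p}\boldsymbol{r}$, $\boldsymbol{Q}_{8}(\underline{\boldsymbol{x}})=\begin{bmatrix}\boldsymbol{Q}(\boldsymbol{r}) & \boldsymbol{0}_{4\times3}\\ \frac{1}{2}\overset{+}{\boldsymbol{H}}_{4}(\boldsymbol{p})\boldsymbol{Q}(\boldsymbol{r}) & \overset{-}{\boldsymbol{H}}_{4}(\boldsymbol{r})\begin{bmatrix}\boldsymbol{0}_{1\times3}\\ \boldsymbol{I}_3\end{bmatrix}\end{bmatrix}$, with $\boldsymbol{Q}(\boldsymbol{r})=\partial\operatorname{vec}_4\boldsymbol{r}/\partial\operatorname{vec}_3\log\boldsymbol{r}$; it is full column rank and satisfies $\operatorname{vec}_8\dot{\underline{\boldsymbol{x}}}=\boldsymbol{Q}_8(\underline{\boldsymbol{x}})\operatorname{vec}_6\frac{d}{dt}\log\underline{\boldsymbol{x}}$.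 $a_{ij}$ are the adjacency-matrix entries of the weighted directed graph $\mathcal{G}$ ($a_{ij}>0$ iff agent $i$ receives information from agent $j$, $a_{ii}=0$). *)

(* Defs.v *)
From HB Require Import structures.
From mathcomp Require Import all_boot all_order all_algebra.
From mathcomp Require Import all_classical all_reals all_analysis.
Set Implicit Arguments. Unset Strict Implicit. Unset Printing Implicit Defensive.
Import Order.TTheory GRing.Theory Num.Theory numFieldNormedType.Exports.
Local Open Scope classical_set_scope.
Local Open Scope ring_scope.

Section DualQuaternions.
Variable R : realType.

(* A quaternion h = h1 + i h2 + j h3 + k h4 is stored as vec4 h : 'cV_4
   (entries 0,1,2,3 = h1,h2,h3,h4).  A dual quaternion h + eps h' is stored as
   vec8 : 'cV_8 with entries 0..3 = vec4 h and entries 4..7 = vec4 h'. *)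

Definition qmul (a b : 'cV[R]_4) : 'cV[R]_4 :=
  let a0 := a 0 0 in let a1 := a 1 0 in let a2 := a 2%:R 0 in let a3 := a 3%:R 0 in
  let b0 := b 0 0 in let b1 := b 1 0 in let b2 := b 2%:R 0 in let b3 := b 3%:R 0 in
  \col_(i < 4)
    (if i == 0 :> nat then a0 * b0 - a1 * b1 - a2 * b2 - a3 * b3
     else if i == 1 :> nat then a0 * b1 + a1 * b0 + a2 * b3 - a3 * b2
     else if i == 2 :> nat then a0 * b2 - a1 * b3 + a2 * b0 + a3 * b1
     else a0 * b3 + a1 * b2 - a2 * b1 + a3 * b0).

Definition qconj (h : 'cV[R]_4) : 'cV[R]_4 :=
  \col_(i < 4) (if i == 0 :> nat then h i 0 else - h i 0).

Definition qim (h : 'cV[R]_4) : 'cV[R]_3 := \col_(i < 3) h (inord i.+1) 0.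

Definition pureq (v : 'cV[R]_3) : 'cV[R]_4 :=
  \col_(i < 4) (if i == 0 :> nat then 0 else v (inord i.-1) 0).

Definition nrm3 (v : 'cV[R]_3) : R := Num.sqrt (\sum_(i < 3) v i 0 ^+ 2).

(* Hamilton operators: vec4(h1 h2) = H4p h1 * vec4 h2 = H4m h2 * vec4 h1 *)
Definition H4p (h : 'cV[R]_4) : 'M[R]_4 :=
  \matrix_(i < 4, j < 4) (qmul h (delta_mx j 0)) i 0.
Definition H4m (h : 'cV[R]_4) : 'M[R]_4 :=
  \matrix_(i < 4, j < 4) (qmul (delta_mx j 0) h) i 0.

Definition prim (x : 'cV[R]_8) : 'cV[R]_4 := \col_(i < 4) x (inord i) 0.
Definition dual (x : 'cV[R]_8) : 'cV[R]_4 := \col_(i < 4) x (inord (i + 4)) 0.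
Definition dq (a b : 'cV[R]_4) : 'cV[R]_8 :=
  \col_(i < 8) (if (i < 4)%N then a (inord i) 0 else b (inord (i - 4)) 0).

Definition dqmul (x y : 'cV[R]_8) : 'cV[R]_8 :=
  dq (qmul (prim x) (prim y))
     (qmul (prim x) (dual y) + qmul (dual x) (prim y)).
Definition dqconj (x : 'cV[R]_8) : 'cV[R]_8 :=
  dq (qconj (prim x)) (qconj (dual x)).
Definition dqone : 'cV[R]_8 := dq (delta_mx 0 0) 0.

Definition unit_dq (x : 'cV[R]_8) : Prop := dqmul x (dqconj x) = dqone.

Definition vec6 (x : 'cV[R]_8) : 'cV[R]_6 :=
  \col_(i < 6) (if (i < 3)%N then (qim (prim x)) (inord i) 0
                else (qim (dual x)) (inord (i - 3)) 0).

(* Hamilton operators for dual quaternions: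
   vec8(h1 h2) = H8p h1 * vec8 h2 = H8m h2 * vec8 h1 *)
Definition H8p (h : 'cV[R]_8) : 'M[R]_8 :=
  \matrix_(i < 8, j < 8) (dqmul h (delta_mx j 0)) i 0.
Definition H8m (h : 'cV[R]_8) : 'M[R]_8 :=
  \matrix_(i < 8, j < 8) (dqmul (delta_mx j 0) h) i 0.

(* Logarithm.  A unit quaternion r = cos(phi/2) + n sin(phi/2), phi in [0,2pi):
   phi = 2 acos(Re r), n = Im r / |Im r| (n is irrelevant when phi = 0).
   The representation with phi in [0,2pi) exists exactly when r <> -1. *)
Definition rphi (r : 'cV[R]_4) : R := 2 * acos (r 0 0).
Definition raxis (r : 'cV[R]_4) : 'cV[R]_3 := (nrm3 (qim r))^-1 *: qim r.

Definition qlog3 (r : 'cV[R]_4) : 'cV[R]_3 := (rphi r / 2) *: raxis r.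

(* for a unit dual quaternion x = r + eps (1/2) p r, p = 2 x' r^* *)
Definition transl (x : 'cV[R]_8) : 'cV[R]_4 :=
  2%:R *: qmul (dual x) (qconj (prim x)).

Definition dqlog (x : 'cV[R]_8) : 'cV[R]_8 :=
  dq (pureq (qlog3 (prim x))) ((1 / 2%:R) *: transl x).

(* unit dual quaternions admitting the representation with phi in [0,2pi),
   i.e. the domain of log *)
Definition log_dom (x : 'cV[R]_8) : Prop := unit_dq x /\ (prim x) 0 0 <> -1.

Definition qexp (w : 'cV[R]_3) : 'cV[R]_4 :=
  \col_(i < 4) (if i == 0 :> nat then cos (nrm3 w)
                else sin (nrm3 w) / nrm3 w * w (inord i.-1) 0).

(* Q(r) = d vec4 r / d vec3 log r (column k = partial derivative along e_k) *)
Definition Qmat (r : 'cV[R]_4) : 'M[R]_(4, 3) :=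
  \matrix_(i < 4, k < 3) (derive qexp (qlog3 r) (delta_mx k 0)) i 0.

Definition Q8 (x : 'cV[R]_8) : 'M[R]_(8, 6) :=
  let r := prim x in
  (block_mx (Qmat r) 0
     ((1 / 2%:R) *: (H4p (transl x) *m Qmat r))
     (H4m r *m col_mx (0 : 'M[R]_(1, 3)) 1%:M) : 'M[R]_(4 + 4, 3 + 3)).

Definition xcen n (delta : 'I_n -> 'cV[R]_8) (x : 'I_n -> R -> 'cV[R]_8)
  (i : 'I_n) (t : R) : 'cV[R]_8 := dqmul (x i t) (dqconj (delta i)).

Definition is_solution n (a : 'I_n -> 'I_n -> R) (delta : 'I_n -> 'cV[R]_8)
  (x : 'I_n -> R -> 'cV[R]_8) : Prop :=
  forall i t, 0 <= t ->
    [/\ unit_dq (x i t), log_dom (xcen delta x i t),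
        derivable (x i) t 1 &
        derive1 (x i) t =
          - (H8m (delta i) *m Q8 (xcen delta x i t) *m
             \sum_(j < n) a i j *: vec6 (dqlog (xcen delta x i t)
                                         - dqlog (xcen delta x j t)))].

Definition achieves_formation n (a : 'I_n -> 'I_n -> R)
  (delta : 'I_n -> 'cV[R]_8) : Prop :=
  forall x, is_solution a delta x ->
    exists xc : 'cV[R]_8, forall i, xcen delta x i t @[t --> +oo] --> xc.

End DualQuaternions.

(* edge j -> i (agent i receives from j) iff 0 < a i j.  A directed spanning
   tree rooted at k: every node i <> k has a parent par i with an edge
   par i -> i, and following parents from any node reaches the root. *)
Definition has_spanning_tree (R : realType) n (a : 'I_n -> 'I_n -> R) : Prop :=
  exists (k : 'I_n) (par : 'I_n -> 'I_n),
    (forall i, i != k -> 0 < a i (par i)) /\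
    (forall i, exists m, iter m par i = k).

(* Main.v *)
Require Import Defs.
From HB Require Import structures.
From mathcomp Require Import all_boot all_order all_algebra.
From mathcomp Require Import all_classical all_reals all_analysis.
From mathcomp Require Import ring lra.
Set Implicit Arguments. Unset Strict Implicit. Unset Printing Implicit Defensive.
Import Order.TTheory GRing.Theory Num.Theory numFieldNormedType.Exports.
Local Open Scope classical_set_scope.
Local Open Scope ring_scope.

(* In logarithmic coordinates the closed loop is linear: each of the six coordinates
   of log x_{c,i} satisfies y_i' = - sum_j a_ij (y_i - y_j).

   If there is a spanning tree, the interval [min_i y_i, max_i y_i] is invariant and
   shrinks by a fixed factor over a fixed time, because the value at the root
   propagates along the tree; hence the y_i converge to a common limit, and so do
   the poses, exp being continuous.

   If there is none, two disjoint nonempty sets of agents receive nothing from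
   outside.  Each yields a left null vector of the Laplacian, so its kernel contains
   a nonconstant vector c, and x_{c,i} = 1 + eps c_i (i + j + k) is an equilibrium
   that is not a consensus. *)

(** * Spanning trees, sets of agents closed under listening, and the kernel of the Laplacian *)

Section Graph.
Variables (R : realType) (n : nat) (a : 'I_n -> 'I_n -> R).

(** Right multiplication by the conjugate of [delta i] cancels [H8m (delta i)], and [Q8] is the
    differential of the exponential, so the protocol prescribes the derivative of the logarithm. Two
    obstacles remain. The rotation logarithm is a 0/0 expression at the identity, and [Qmat] is
    given only through partial derivatives of [qexp]; both are made explicit, with the identity
    treated apart. Moreover, rotation enters the derivative of the translation, but its contribution
    is twice the inner product of [r] with a tangent vector at [r], hence zero. The convergence
    argument works with minima and maxima instead of the spectrum of the Laplacian: the shrinking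
    factor depends on the graph alone, so it applies again at every later time and serves all six
    coordinates alike. Passing back to poses uses only continuity of the exponential, so the limit
    may be formed without asking whether it lies in the domain of the logarithm. *)

Definition edge : rel 'I_n := fun i j => 0 < a i j.

(** [edge] points from receiver to sender, so [connect edge i k] means that information from [k]
    reaches [i]. The tree is a shortest-path tree: [d i] is the distance to [k], a parent is a
    neighbour strictly closer to [k], and following parents must therefore end at [k]. *)
Lemma root_spanning_tree (k : 'I_n) :
  (forall i, connect edge i k) -> has_spanning_tree a.
Proof.
move=> hk.
pose P i m := [exists p : m.-tuple 'I_n, path edge i p && (last i p == k)].
have hP i : exists m, P i m.
  have /connectP[p ep kE] := hk i.
  by exists (size p); apply/existsP; exists (in_tuple p); rewrite /= ep -kE eqxx.
pose d i := ex_minn (hP i).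
have dP i : P i (d i) by rewrite /d; case: ex_minnP.
have dmin i m : P i m -> (d i <= m)%N by rewrite /d; case: ex_minnP => ? _; apply.
pose par i := odflt i [pick j | edge i j && (d j < d i)%N].
have parP i : i != k -> edge i (par i) && (d (par i) < d i)%N.
  move=> ik; rewrite /par; case: pickP => //= /= nopar.
  have /existsP[[p /= /eqP sp] /andP[ep /eqP lp]] := dP i.
  case: p sp ep lp => [_ _ ki|j p sp /= /andP[eij ep] lp].
    by move: ik; rewrite -ki eqxx.
  have := nopar j; rewrite eij /= -sp /= ltnS dmin//.
  by apply/existsP; exists (in_tuple p); rewrite /= ep lp eqxx.
exists k, par; split=> [i /parP/andP[]//|i].
have [m] := ubnP (d i); elim: m i => // m IH i.
rewrite ltnS => dim; have [->|ik] := eqVneq i k; first by exists 0%N.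
have /andP[_ lt] := parP i ik.
have [m' hm'] := IH (par i) (leq_trans lt dim).
by exists m'.+1; rewrite iterSr.
Qed.

Definition closed_set (S : {set 'I_n}) := forall i j, i \in S -> edge i j -> j \in S.

(** A reachable set of least cardinality is a terminal strongly connected component: each of its
    members reaches [i0] back. If it met every other reachable set, [i0] would be reachable from
    everywhere and root a tree; so some reachable set is disjoint from it. *)
Lemma disjoint_closed_sets : (0 < n)%N -> ~ has_spanning_tree a ->
  exists S1 S2 : {set 'I_n}, [/\ closed_set S1, closed_set S2,
    S1 != finset.set0, S2 != finset.set0 & S1 :&: S2 = finset.set0].
Proof.
move=> n0 notree.
pose reach i := [set j | connect edge i j]%SET.
have reach_closed i : closed_set (reach i).
  by move=> j l; rewrite !inE => ij jl; apply: connect_trans ij (connect1 jl).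
have reach0 i : reach i != finset.set0.
  by apply/set0Pn; exists i; rewrite inE connect0.
pose i0 := [arg min_(i < Ordinal n0) #|reach i|].
have min0 j : (#|reach i0| <= #|reach j|)%N.
  by rewrite /i0; case: arg_minnP => // i _; apply.
have back j : j \in reach i0 -> connect edge j i0.
  rewrite inE => i0j.
  have sub : reach j \subset reach i0.
    by apply/fintype.subsetP => l; rewrite !inE; apply: connect_trans.
  have /eqP rE : reach j == reach i0 by rewrite eqEcard sub min0.
  by have : i0 \in reach i0 by [rewrite inE connect0]; rewrite -rE inE.
have [/forallP root|] := boolP [forall l, reach i0 :&: reach l != finset.set0].
  exfalso; apply/notree/(root_spanning_tree (k := i0)) => l.
  have := root l; move=> /set0Pn[j]; rewrite finset.in_setI => /andP[ij].
  by rewrite inE => lj; apply: connect_trans lj (back _ ij).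
rewrite negb_forall => /existsP[l]; rewrite negbK => /eqP dis.
by exists (reach i0), (reach l); split.
Qed.

Definition laplacian : 'M[R]_n :=
  \matrix_(i, j) ((\sum_l a i l) * (i == j)%:R - a i j).

Lemma laplacianE (v : 'cV[R]_n) i :
  (laplacian *m v) i 0 = \sum_j a i j * (v i 0 - v j 0).
Proof.
rewrite mxE (eq_bigr (fun j => (\sum_l a i l) * ((i == j)%:R * v j 0) - a i j * v j 0)); last first.
  by move=> j _; rewrite mxE mulrBl -mulrA.
have -> : \sum_j ((\sum_l a i l) * ((i == j)%:R * v j 0) - a i j * v j 0) =
  (\sum_l a i l) * v i 0 - \sum_j a i j * v j 0.
  rewrite sumrB -mulr_sumr; congr (_ * _ - _).
  rewrite (bigD1 i)//= eqxx mul1r big1 ?addr0// => j ji.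
  by rewrite eq_sym (negPf ji) mul0r.
by rewrite mulr_suml -sumrB; apply: eq_bigr => j _; rewrite mulrBr.
Qed.

Hypothesis a_ge0 : forall i j, 0 <= a i j.

(* The rows of the Laplacian indexed by a closed set S only involve columns in S,
   and this diagonal block kills the constant vector, hence is singular. *)
Lemma closed_set_left_kernel (S : {set 'I_n}) : closed_set S -> S != finset.set0 ->
  exists u : 'rV[R]_n, [/\ u != 0, u *m laplacian = 0 & forall i, i \notin S -> u 0 i = 0].
Proof.
move=> clS /set0Pn[s sS].
(* Identity rows outside [S] keep the matrix square of size [n], so that no block has to be
   extracted; [u *m M = 0] then forces [u] to vanish off [S]. *)
pose M : 'M[R]_n := \matrix_(i, j) (if i \in S then laplacian i j else (i == j)%:R).
pose v : 'cV[R]_n := \col_j (j \in S)%:R.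
have Mv : M *m v = 0.
  apply/colP => i; rewrite [RHS]mxE; have [iS|iS] := boolP (i \in S).
    have -> : (M *m v) i 0 = (laplacian *m v) i 0.
      by rewrite !mxE; apply: eq_bigr => j _; rewrite [M _ _]mxE iS.
    rewrite laplacianE; apply: big1 => j _; rewrite !mxE iS.
    have [jS|jS] := boolP (j \in S); first by rewrite subrr mulr0.
    have : ~~ edge i j by apply: contra jS; apply: clS.
    by rewrite /edge lt0r a_ge0 andbT negbK => /eqP->; rewrite mul0r.
  rewrite mxE; apply: big1 => j _; rewrite !mxE (negPf iS).
  by case: eqVneq => [<-|]; rewrite ?(negPf iS) ?mul0r ?mulr0.
have : \det M^T == 0.
  apply/det0P; exists v^T; last by rewrite -trmx_mul Mv trmx0.
  by apply/eqP => /rowP/(_ s); rewrite !mxE sS => /eqP; rewrite oner_eq0.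
rewrite det_tr => /det0P[u u0 uM].
have uS i : i \notin S -> u 0 i = 0.
  move=> iS; have /rowP/(_ i) := uM; rewrite !mxE (bigD1 i)//= mxE (negPf iS) eqxx mulr1.
  rewrite big1 ?addr0// => j ji; rewrite mxE.
  case: ifP => jS; last by rewrite (negPf ji) mulr0.
  rewrite mxE (negPf ji) mulr0 sub0r.
  have : ~~ edge j i by apply: contra iS; apply: clS.
  by rewrite /edge lt0r a_ge0 andbT negbK => /eqP->; rewrite oppr0 mulr0.
exists u; split=> //; rewrite -uM; apply/rowP => i; rewrite !mxE.
apply: eq_bigr => j _; rewrite [M _ _]mxE; case: ifPn => // jS.
by rewrite uS// !mul0r.
Qed.

(** Otherwise the right kernel of the Laplacian would contain only constants, so it would have
    dimension at most one, and by equality of row and column rank so would the left kernel. But the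
    left null vectors of two disjoint closed sets are nonzero with disjoint supports, hence not
    proportional. *)
Lemma nonconstant_harmonic : (0 < n)%N -> ~ has_spanning_tree a ->
  exists c : 'I_n -> R,
    (forall i, \sum_j a i j * (c i - c j) = 0) /\ exists i j, c i <> c j.
Proof.
move=> n0 /(disjoint_closed_sets n0)[S1 [S2 [cl1 cl2 ne1 ne2 dis]]].
have [u1 [u1n0 u1L u1S]] := closed_set_left_kernel cl1 ne1.
have [u2 [u2n0 u2L u2S]] := closed_set_left_kernel cl2 ne2.
apply: contrapT => noc.
have cst (v : 'rV[R]_n) : v *m laplacian^T = 0 -> (v <= (const_mx 1 : 'rV[R]_n))%MS.
  move=> vL; apply/sub_rVP; exists (v 0 (Ordinal n0)).
  apply/rowP => j; rewrite !mxE mulr1; apply: contrapT => vj; apply: noc.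
  exists (fun j => v 0 j); split; last by exists j, (Ordinal n0).
  move=> i; have := laplacianE v^T i.
  rewrite -[laplacian in X in X -> _]trmxK -trmx_mul vL 2!mxE => E.
  rewrite [RHS]E.
  by apply: eq_bigr => l _; rewrite !mxE.
have rk : (\rank (kermx laplacian^T) <= 1)%N.
  apply: leq_trans (rank_leq_row (const_mx 1 : 'rV[R]_n)).
  apply/mxrankS/row_subP => i; apply: cst.
  by rewrite -row_mul mulmx_ker row0.
have rkL : (\rank (kermx laplacian) <= 1)%N by rewrite mxrank_ker -mxrank_tr -mxrank_ker.
have sub1 : (kermx laplacian <= u1)%MS.
  have s1 : (u1 <= kermx laplacian)%MS by apply/sub_kermxP.
  rewrite -(geq_leqif (mxrank_leqif_sup s1)); apply: leq_trans rkL _.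
  by rewrite rank_rV u1n0.
have s2 : (u2 <= u1)%MS by apply: submx_trans sub1; apply/sub_kermxP.
have /sub_rVP[c u2E] := s2.
move/eqP: u2n0; apply; apply/rowP => i; rewrite [RHS]mxE.
have [iS|iS] := boolP (i \in S2); last exact: u2S.
rewrite u2E mxE u1S ?mulr0//.
apply: contraTN isT => iS1; have /setP/(_ i) := dis.
by rewrite !inE iS iS1.
Qed.

End Graph.

(** * One-variable differentiation rules in pointwise form *)

Section PointwiseDerivatives.
Variable R : realType.
Implicit Types (f g : R -> R) (x df dg : R).

Lemma is_derive_mul f g x df dg : is_derive x 1 f df -> is_derive x 1 g dg ->
  is_derive x 1 (fun t => f t * g t) (df * g x + f x * dg).
Proof.
move=> hf hg; apply: is_derive_eq (is_deriveM hf hg) _.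
by rewrite /GRing.scale /= addrC [g x * df]mulrC.
Qed.

Lemma is_derive_add f g x df dg : is_derive x 1 f df -> is_derive x 1 g dg ->
  is_derive x 1 (fun t => f t + g t) (df + dg).
Proof. exact: is_deriveD. Qed.

Lemma is_derive_sub f g x df dg : is_derive x 1 f df -> is_derive x 1 g dg ->
  is_derive x 1 (fun t => f t - g t) (df - dg).
Proof. exact: is_deriveB. Qed.

Lemma is_derive_opp f x df : is_derive x 1 f df ->
  is_derive x 1 (fun t => - f t) (- df).
Proof. exact: is_deriveN. Qed.

Lemma is_derive_const (c : R) x : is_derive x 1 (fun=> c) 0.
Proof. exact: is_derive_cst. Qed.

Lemma is_derive_mulC (c : R) f x df : is_derive x 1 f df ->
  is_derive x 1 (fun t => c * f t) (c * df).
Proof.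
by move=> hf; apply: is_derive_eq (is_derive_mul (is_derive_const c x) hf) _;
  rewrite mul0r add0r.
Qed.

Lemma is_derive_bigsum n (f : 'I_n -> R -> R) x (df : 'I_n -> R) :
  (forall i, is_derive x 1 (f i) (df i)) ->
  is_derive x 1 (fun t => \sum_i f i t) (\sum_i df i).
Proof.
move=> hf; have := @is_derive_sum R R R n f x 1 df hf.
by congr is_derive; apply/funext => t; rewrite fct_sumE.
Qed.

Lemma is_derive_compose f g x df dg : is_derive (g x) 1 f df ->
  is_derive x 1 g dg -> is_derive x 1 (fun t => f (g t)) (df * dg).
Proof. exact: is_derive1_comp. Qed.

Lemma is_derive_continuous f x df : is_derive x 1 f df -> {for x, continuous f}.
Proof. by move=> [hf _]; apply/differentiable_continuous/derivable1_diffP. Qed.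

Lemma is_derive_within_continuous f (df : R -> R) (a b : R) :
  (forall t, a <= t <= b -> is_derive t 1 f (df t)) ->
  {within `[a, b], continuous f}.
Proof.
move=> hf; apply: derivable_within_continuous => t; rewrite in_itv/= => tab.
by have [] := hf t tab.
Qed.

(** Caratheodory's slope [g] is continuous at [s] with value [d]; were it positive there, [f] would
    be smaller slightly to the left of [s]. *)
Lemma is_derive_left_min f (s d b : R) : is_derive s 1 f d -> b < s ->
  (forall t, b <= t <= s -> f s <= f t) -> d <= 0.
Proof.
move=> /is_derive1_caratheodory[g [fg gc <-]] bs fmin.
rewrite leNgt; apply/negP => gs0.
have : \forall z \near s, 0 < g z by exact: cvgr_gt gc _ gs0.
move=> [e /= e0 he].
(* [e / 2] keeps [s - h] inside the ball of radius [e], and [s - b] keeps it in the interval on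
   which [f] is minimal at [s]. *)
pose h := Num.min (e / 2) (s - b).
have h0 : 0 < h by rewrite lt_min divr_gt0//= subr_gt0.
have hs : h <= s - b by rewrite ge_min lexx orbT.
have he2 : h <= e / 2 by rewrite ge_min lexx.
have gh : 0 < g (s - h).
  by apply: he; rewrite /ball/= opprB addrC subrK gtr0_norm//; lra.
have := fg (s - h); have := fmin (s - h).
have -> : s - h - s = - h by ring.
rewrite mulrN => /(_ _)/wrap[]; first by apply/andP; split; lra.
move=> le1 E; have := mulr_gt0 gh h0; lra.
Qed.

End PointwiseDerivatives.

(** * Convergence of the scalar Laplacian flow *)

Section Consensus.
Variables (R : realType) (n : nat) (a : 'I_n -> 'I_n -> R).
Hypothesis a_ge0 : forall i j, 0 <= a i j.
Implicit Type y : 'I_n -> R -> R.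

(** Time 0 is left out because the derivative is two-sided while poses are known to be unit only
    from time 0 on, so the logarithm can be differentiated only at positive times. *)
Definition laplacian_flow y := forall i (t : R), 0 < t ->
  is_derive t 1 (y i) (- \sum_j a i j * (y i t - y j t)).

Lemma laplacian_flowN y : laplacian_flow y -> laplacian_flow (fun i t => - y i t).
Proof.
move=> hy i t t0; apply: is_derive_eq (is_derive_opp (hy i t t0)) _.
congr (- _); rewrite -sumrN; apply: eq_bigr => j _; ring.
Qed.

(* At a minimum over i and t of e^(-t) (y_i(t) - m), a negative value would force
   a positive time derivative there. *)
Lemma laplacian_flow_ge y (m t0 : R) : laplacian_flow y -> 0 < t0 ->
  (forall i, m <= y i t0) -> forall i t, t0 <= t -> m <= y i t.
Proof.
move=> hy t00 ym i0 T t0T.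
pose g i t := expR (- t) * (y i t - m).
have hg i (t : R) : 0 < t -> is_derive t 1 (g i)
    (- g i t - \sum_j a i j * (g i t - g j t)).
  move=> tt; have he : is_derive t 1 (fun t => expR (- t)) (- expR (- t)).
    apply: is_derive_eq (is_derive_compose (is_derive_expR _)
       (is_derive_opp (is_derive_id t 1))) _.
    by rewrite mulrN1.
  apply: is_derive_eq (is_derive_mul he (is_derive_sub (hy i t tt)
      (is_derive_const m t))) _.
  rewrite subr0 mulNr mulrN mulr_sumr; congr (_ - _).
  by apply: eq_bigr => j _; rewrite /g; ring.
have EVT i : exists s, t0 <= s <= T /\ forall t, t0 <= t <= T -> g i s <= g i t.
  have [] := @EVT_min R (g i) t0 T t0T.
    apply: is_derive_within_continuous => t /andP[t0t _].
    by apply: hg; apply: lt_le_trans t0t.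
  by move=> s; rewrite in_itv/= => hs smin; exists s.
have /choice[s hs] := EVT.
pose i := [arg min_(i < i0) g i (s i)]%O.
have imin j : g i (s i) <= g j (s j) by rewrite /i; case: arg_minP => // l _; apply.
have [/andP[t0s sT] smin] := hs i.
have gj j t : t0 <= t <= T -> g i (s i) <= g j t.
  by move=> ht; apply: le_trans (imin j) _; apply: (hs j).2.
have [g0|g0] := leP 0 (g i (s i)).
  have := le_trans g0 (gj i0 T _); rewrite t0T lexx => /(_ isT).
  by rewrite pmulr_rge0 ?expR_gt0// subr_ge0.
have s0 : t0 < s i.
  rewrite lt_neqAle t0s andbT; apply: contraTneq g0 => <-.
  by rewrite -leNgt mulr_ge0 ?expR_ge0// subr_ge0.
have := is_derive_left_min (hg i _ (lt_trans t00 s0)) s0.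
move=> /(_ _)/wrap[t /andP[t0t ts]|]; first by apply: gj; rewrite t0t (le_trans ts).
rewrite leNgt => /negP[]; rewrite -sumrN ltr_wpDr ?oppr_gt0// sumr_ge0// => j _.
by rewrite -mulrN mulr_ge0// oppr_ge0 subr_le0 gj// t0s sT.
Qed.

Let D := \sum_i \sum_j a i j.

(** An integrating factor. As [D] bounds every row sum of the weights, it turns the equation for the
    excess over [m] into one with nonnegative coefficients, [dv]: the boosted excess never
    decreases, and each neighbour pushes it up at a rate of at least [a i j] times the neighbour's
    own. *)
Definition boosted y (m t0 : R) i (t : R) := expR (D * (t - t0)) * (y i t - m).

Section Boosted.
Variables (y : 'I_n -> R -> R) (m t0 : R).
Hypotheses (hy : laplacian_flow y) (t0_gt0 : 0 < t0) (ym : forall j, m <= y j t0).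
Local Notation v := (boosted y m t0).

Lemma boosted_ge0 i t : t0 <= t -> 0 <= v i t.
Proof.
by move=> t0t; rewrite mulr_ge0 ?expR_ge0// subr_ge0 (laplacian_flow_ge hy t0_gt0 ym).
Qed.

Let dv i t := (D - \sum_j a i j) * v i t + \sum_j a i j * v j t.

Lemma is_derive_boosted i (t : R) : t0 <= t -> is_derive t 1 (v i) (dv i t).
Proof.
move=> t0t; have tt : 0 < t by apply: lt_le_trans t0t.
have he : is_derive t 1 (fun t => expR (D * (t - t0))) (D * expR (D * (t - t0))).
  apply: is_derive_eq (is_derive_compose (is_derive_expR _) (is_derive_mulC D
    (is_derive_sub (is_derive_id t 1) (is_derive_const t0 t)))) _.
  by rewrite subr0 mulr1 mulrC.
apply: is_derive_eq (is_derive_mul he (is_derive_sub (hy i tt)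
  (is_derive_const m t))) _.
rewrite subr0 /dv mulrBl -addrA -mulrA; congr (_ + _).
rewrite mulrN mulr_sumr [X in - X + _]mulr_suml -!sumrN -big_split/=.
by apply: eq_bigr => j _; rewrite /boosted; ring.
Qed.

Lemma boosted_slope_ge i j t : t0 <= t -> a i j * v j t <= dv i t.
Proof.
move=> t0t; apply: le_trans (_ : \sum_j a i j * v j t <= _).
  rewrite (bigD1 j)//= lerDl sumr_ge0// => l _; apply: mulr_ge0 => //.
  exact: boosted_ge0.
rewrite lerDr mulr_ge0 ?boosted_ge0// subr_ge0 /D [leRHS](bigD1 i)//= lerDl.
by rewrite sumr_ge0// => l _; rewrite sumr_ge0.
Qed.

Lemma boosted_increase i j b s t : t0 <= s -> s <= t ->
  (forall u, s <= u <= t -> b <= v j u) -> a i j * b * (t - s) <= v i t - v i s.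
Proof.
move=> t0s st hb.
have [||u] := @MVT_segment R (v i) (dv i) s t st.
- move=> u; rewrite in_itv/= => /andP[su _].
  by apply: is_derive_boosted; rewrite (le_trans t0s)// ltW.
- apply: is_derive_within_continuous => u /andP[su _].
  by apply: is_derive_boosted; rewrite (le_trans t0s).
rewrite in_itv/= => ut ->; rewrite ler_wpM2r ?subr_ge0//.
have /andP[su _] := ut.
apply: le_trans (boosted_slope_ge i j (le_trans t0s su)).
by rewrite ler_wpM2l// hb.
Qed.

Lemma boosted_nondecreasing i s t : t0 <= s -> s <= t -> v i s <= v i t.
Proof.
move=> t0s st; rewrite -subr_ge0.
have := @boosted_increase i i 0 s t t0s st; rewrite mulr0 mul0r; apply.
by move=> u /andP[su _]; rewrite boosted_ge0// (le_trans t0s).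
Qed.

End Boosted.

(** Induction on the number of steps to the root, with one unit of time per edge: on [t - 1, t] the
    parent is already bounded below, and [boosted_increase] passes the bound on with the factor
    [a i (par i)]. The constant is chosen before [y], [m] and [t0], which is what makes iteration
    possible. *)
Lemma boosted_propagate (k : 'I_n) (par : 'I_n -> 'I_n) :
  (forall i, i != k -> 0 < a i (par i)) ->
  forall p i, iter p par i = k -> exists2 c, 0 < c & forall y m t0,
    laplacian_flow y -> 0 < t0 -> (forall j, m <= y j t0) ->
    forall t, t0 + p%:R <= t -> c * (y k t0 - m) <= boosted y m t0 i t.
Proof.
move=> hpar; elim=> [|p IH] i.
  move=> /= ->; exists 1 => // y m t0 hy t00 ym t; rewrite addr0 => t0t.
  have := boosted_nondecreasing hy t00 ym k (lexx t0) t0t.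
  by rewrite {1}/boosted subrr mulr0 expR0 mul1r.
rewrite iterSr => /IH[c c0 hc].
(* The chain of parents may start at the root and return to it, and nothing guarantees an edge from
   [k] to [par k]; agent [k] is bounded by its own initial value instead. *)
have [->|ik] := eqVneq i k.
  exists 1 => // y m t0 hy t00 ym t t0t.
  have t0t' : t0 <= t by apply: le_trans t0t; rewrite lerDl.
  have := boosted_nondecreasing hy t00 ym k (lexx t0) t0t'.
  by rewrite {1}/boosted subrr mulr0 expR0 mul1r.
exists (a i (par i) * c); first by rewrite mulr_gt0// hpar.
move=> y m t0 hy t00 ym t; rewrite -natr1 addrA => t0t.
have p0 : 0 <= p%:R :> R by [].
have t0t1 : t0 <= t - 1 by lra.
have t1t : t - 1 <= t by lra.
have := @boosted_increase y m t0 hy t00 ym i (par i) (c * (y k t0 - m)) _ _ t0t1 t1t.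
have -> : t - (t - 1) = 1 by ring.
rewrite mulr1 mulrA => /(_ _)/wrap[].
  by move=> u /andP[tu _]; apply: hc => //; lra.
by have := boosted_ge0 hy t00 ym i t0t1; lra.
Qed.

Lemma laplacian_flow_le y (M t0 : R) : laplacian_flow y -> 0 < t0 ->
  (forall i, y i t0 <= M) -> forall i t, t0 <= t -> y i t <= M.
Proof.
move=> /laplacian_flowN hy t00 yM i t t0t; rewrite -lerN2.
by apply: (laplacian_flow_ge hy t00) => // j; rewrite lerN2.
Qed.

Hypothesis tree : has_spanning_tree a.

Lemma spanning_tree_lift : exists k N eta, [/\ 0 <= N, 0 < eta <= 1 & forall y m t0,
  laplacian_flow y -> 0 < t0 -> (forall j, m <= y j t0) ->
  forall i, m + eta * (y k t0 - m) <= y i (t0 + N)].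
Proof.
have [k [par [hpar reach]]] := tree.
have /choice[p hp] := reach.
have hc i : exists c, 0 < c /\ forall y m t0,
    laplacian_flow y -> 0 < t0 -> (forall j, m <= y j t0) ->
    forall t, t0 + (p i)%:R <= t -> c * (y k t0 - m) <= boosted y m t0 i t.
  by have [c c0 ?] := boosted_propagate hpar (hp i); exists c.
have /choice[c cP] := hc.
(* Starting the minimum at 1 secures [eta <= 1]; the sum [N] dominates all depths at once. *)
pose c0 := \big[Order.min/1]_i c i.
pose N := (\sum_i p i)%N.
have c0_gt0 : 0 < c0 by apply: lt_bigmin => // i _; exact: (cP i).1.
have D0 : 0 <= D by apply: sumr_ge0 => i _; apply: sumr_ge0.
(* The exponential undoes the boost accumulated over a time [N]. *)
exists k, N%:R, (c0 * expR (- (D * N%:R))); split=> //.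
  rewrite mulr_gt0 ?expR_gt0//= mulr_ile1 ?expR_ge0//; first exact: ltW.
    exact: bigmin_le_id.
  by rewrite -expR0 ler_expR oppr_le0 mulr_ge0.
move=> y m t0 hy t00 ym i.
have pN : t0 + (p i)%:R <= t0 + N%:R.
  by rewrite lerD2l ler_nat /N (bigD1 i)//= leq_addr.
have := (cP i).2 y m t0 hy t00 ym _ pN; rewrite /boosted.
have -> : t0 + N%:R - t0 = N%:R by ring.
move=> le1; rewrite addrC -lerBrDr -(ler_pM2l (expR_gt0 (D * N%:R))).
apply: le_trans le1; rewrite mulrA mulrCA -expRD subrr expR0 mulr1.
by rewrite ler_wpM2r ?subr_ge0// bigmin_le.
Qed.

(** The root lies in the upper or in the lower half of [m, M]. In the upper half it lifts the lower
    bound by eta (M - m) / 2; in the lower half the same applied to [- y] reduces the upper bound by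
    as much. Hence the factor 1 - eta / 2. *)
Lemma consensus_contraction : exists N q, [/\ 0 <= N, 0 <= q < 1 & forall y m M t0,
  laplacian_flow y -> 0 < t0 -> (forall j, m <= y j t0 <= M) ->
  exists m' M', M' - m' <= q * (M - m) /\ forall j, m' <= y j (t0 + N) <= M'].
Proof.
have [k [N [eta [N0 /andP[eta0 eta1] lift]]]] := spanning_tree_lift.
exists N, (1 - eta / 2); split=> //; first by apply/andP; split; lra.
move=> y m M t0 hy t00 ymM.
have ym j : m <= y j t0 by have /andP[] := ymM j.
have yM j : y j t0 <= M by have /andP[] := ymM j.
have t0N : t0 <= t0 + N by rewrite lerDl.
have [kc|kc] := leP ((m + M) / 2) (y k t0).
  exists (m + eta * ((M - m) / 2)), M; split; first by lra.
  move=> j; rewrite (laplacian_flow_le hy t00 yM)// andbT.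
  apply: le_trans (lift y m t0 hy t00 ym j); rewrite lerD2l ler_pM2l//; lra.
exists m, (M - eta * ((M - m) / 2)); split; first by lra.
move=> j; rewrite (laplacian_flow_ge hy t00 ym)//=.
have yM' i : - M <= - y i t0 by rewrite lerN2.
have := lift _ (- M) t0 (laplacian_flowN hy) t00 yM' j => /= lj.
have : eta * ((M - m) / 2) <= eta * (- y k t0 - - M) by rewrite ler_pM2l//; lra.
lra.
Qed.

Lemma consensus_squeeze y : laplacian_flow y -> forall e, 0 < e ->
  exists m M T, [/\ 0 < T, M - m <= e & forall t, T <= t -> forall j, m <= y j t <= M].
Proof.
move=> hy e e0.
have [N [q [N0 /andP[q0 q1] step]]] := consensus_contraction.
(* Time 1 is an arbitrary positive starting time, as the flow equation is available only after 0. *)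
have [m0 [M0 ymM0]] : exists m M, forall j, m <= y j 1 <= M.
  exists (- \sum_j `|y j 1|), (\sum_j `|y j 1|) => j.
  by rewrite -ler_norml (bigD1 j)//= lerDl sumr_ge0.
have iterate p : exists m M, M - m <= q ^+ p * (M0 - m0) /\
    forall j, m <= y j (1 + N * p%:R) <= M.
  elim: p => [|p [m [M [mM ymM]]]].
    by exists m0, M0; rewrite expr0 mul1r mulr0 addr0.
  have tp : 0 < 1 + N * p%:R by rewrite ltr_pwDl// mulr_ge0.
  have [m' [M' [mM' ymM']]] := step y m M _ hy tp ymM.
  exists m', M'; split.
    by apply: le_trans mM' _; rewrite exprS -mulrA ler_wpM2l.
  by rewrite -natr1 mulrDr mulr1 addrA.
have [p hp] : exists p, q ^+ p * (M0 - m0) <= e.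
  have : q ^+ p * (M0 - m0) @[p --> \oo] --> 0 * (M0 - m0).
    apply: cvgM; last exact: cvg_cst.
    by apply: cvg_expr; rewrite ger0_norm.
  rewrite mul0r => /cvgr_le/(_ e e0)[p _ hp]; exists p; exact: hp p (leqnn _).
have [m [M [mM ymM]]] := iterate p.
have T0 : 0 < 1 + N * p%:R by rewrite ltr_pwDl// mulr_ge0.
exists m, M, (1 + N * p%:R); split=> //; first exact: le_trans mM hp.
move=> t Tt j; rewrite (laplacian_flow_ge hy T0)//=; last by move=> i; have /andP[] := ymM i.
by rewrite (laplacian_flow_le hy T0)// => i; have /andP[] := ymM i.
Qed.

(** The candidate limit is the supremum of all eventual lower bounds. It lies in every squeezing
    interval, as does each [y i t] for large [t]; the root [k] supplies an agent at which lower and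
    upper bounds are compared. *)
Lemma laplacian_flow_consensus y : laplacian_flow y ->
  exists c : R, forall i, y i t @[t --> +oo] --> c.
Proof.
move=> hy; have sq := consensus_squeeze hy.
have [k _] := tree.
pose A := [set m | exists2 T, 0 < T & forall t, T <= t -> forall j, m <= y j t].
have AM M T m : (forall t, T <= t -> forall j, y j t <= M) -> A m -> m <= M.
  move=> hM [S S0 hm].
  apply: le_trans (hm (Order.max S T) _ k) (hM _ _ k); rewrite le_max lexx ?orbT//.
exists (sup A) => i; apply/cvgrPdist_le => e e0.
have [m [M [T [T0 mM ymM]]]] := sq e e0.
have Am : A m by exists T => // t Tt j; have /andP[] := ymM t Tt j.
have ubM : ubound A M.
  by move=> m'; apply: (AM M T) => t Tt j; have /andP[] := ymM t Tt j.
have mc : m <= sup A by apply: ub_le_sup => //; exists M.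
have cM : sup A <= M by apply: ge_sup => //; exists m.
near=> t.
have /andP[mt tM] : m <= y i t <= M.
  by apply: ymM; near: t; apply: nbhs_pinfty_ge; rewrite num_real.
by rewrite ler_norml; apply/andP; split; lra.
Unshelve. all: by end_near. Qed.

End Consensus.

(** * Quaternion and dual quaternion algebra, and the Hamilton operators *)

Section Quaternion.
Variable R : realType.
Implicit Types (p q r : 'cV[R]_4) (x y z : 'cV[R]_8).

Lemma ord3_cases (P : 'I_3 -> Prop) :
  P 0 -> P 1 -> P 2%:R -> forall i, P i.
Proof.
move=> P0 P1 P2 [[|[|[|//]]] Hi];
  [have -> : Ordinal Hi = 0|have -> : Ordinal Hi = 1|have -> : Ordinal Hi = 2%:R];
  by [apply/val_inj|].
Qed.

Lemma ord4_cases (P : 'I_4 -> Prop) :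
  P 0 -> P 1 -> P 2%:R -> P 3%:R -> forall i, P i.
Proof.
move=> P0 P1 P2 P3 [[|[|[|[|//]]]] Hi];
  [have -> : Ordinal Hi = 0|have -> : Ordinal Hi = 1|
   have -> : Ordinal Hi = 2%:R|have -> : Ordinal Hi = 3%:R];
  by [apply/val_inj|].
Qed.

Lemma quat_eq p q : p 0 0 = q 0 0 -> p 1 0 = q 1 0 -> p 2%:R 0 = q 2%:R 0 ->
  p 3%:R 0 = q 3%:R 0 -> p = q.
Proof. by move=> *; apply/colP; apply: ord4_cases. Qed.

Lemma qmul0E p q : qmul p q 0 0 =
  p 0 0 * q 0 0 - p 1 0 * q 1 0 - p 2%:R 0 * q 2%:R 0 - p 3%:R 0 * q 3%:R 0.
Proof. by rewrite mxE. Qed.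
Lemma qmul1E p q : qmul p q 1 0 =
  p 0 0 * q 1 0 + p 1 0 * q 0 0 + p 2%:R 0 * q 3%:R 0 - p 3%:R 0 * q 2%:R 0.
Proof. by rewrite mxE. Qed.
Lemma qmul2E p q : qmul p q 2%:R 0 =
  p 0 0 * q 2%:R 0 - p 1 0 * q 3%:R 0 + p 2%:R 0 * q 0 0 + p 3%:R 0 * q 1 0.
Proof. by rewrite mxE. Qed.
Lemma qmul3E p q : qmul p q 3%:R 0 =
  p 0 0 * q 3%:R 0 + p 1 0 * q 2%:R 0 - p 2%:R 0 * q 1 0 + p 3%:R 0 * q 0 0.
Proof. by rewrite mxE. Qed.
Definition qmulE := (qmul0E, qmul1E, qmul2E, qmul3E).

Lemma qconj0E p : qconj p 0 0 = p 0 0. Proof. by rewrite mxE. Qed.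
Lemma qconj1E p : qconj p 1 0 = - p 1 0. Proof. by rewrite mxE. Qed.
Lemma qconj2E p : qconj p 2%:R 0 = - p 2%:R 0. Proof. by rewrite mxE. Qed.
Lemma qconj3E p : qconj p 3%:R 0 = - p 3%:R 0. Proof. by rewrite mxE. Qed.
Definition qconjE := (qconj0E, qconj1E, qconj2E, qconj3E).

Lemma inord0 n : inord 0 = 0 :> 'I_n.+1.
Proof. by apply/val_inj; rewrite /= inordK. Qed.

Lemma inord_nat n k : (k < n.+2)%N -> inord k = k%:R :> 'I_n.+2.
Proof. by move=> kn; apply/val_inj; rewrite /= inordK// Zp_nat /= modn_small. Qed.

Definition qone : 'cV[R]_4 := delta_mx 0 0.
Lemma qone0E : qone 0 0 = 1. Proof. by rewrite mxE. Qed.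
Lemma qone1E : qone 1 0 = 0. Proof. by rewrite mxE. Qed.
Lemma qone2E : qone 2%:R 0 = 0. Proof. by rewrite mxE. Qed.
Lemma qone3E : qone 3%:R 0 = 0. Proof. by rewrite mxE. Qed.
Definition qoneE := (qone0E, qone1E, qone2E, qone3E).

Lemma pureq0E (v : 'cV[R]_3) : pureq v 0 0 = 0. Proof. by rewrite mxE. Qed.
Lemma pureq1E (v : 'cV[R]_3) : pureq v 1 0 = v 0 0.
Proof. by rewrite mxE /= inord0. Qed.
Lemma pureq2E (v : 'cV[R]_3) : pureq v 2%:R 0 = v 1 0.
Proof. by rewrite mxE /= inord_nat. Qed.
Lemma pureq3E (v : 'cV[R]_3) : pureq v 3%:R 0 = v 2%:R 0.
Proof. by rewrite mxE /= inord_nat. Qed.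
Definition pureqE := (pureq0E, pureq1E, pureq2E, pureq3E).

Lemma qim0E p : qim p 0 0 = p 1 0. Proof. by rewrite mxE inord_nat. Qed.
Lemma qim1E p : qim p 1 0 = p 2%:R 0. Proof. by rewrite mxE inord_nat. Qed.
Lemma qim2E p : qim p 2%:R 0 = p 3%:R 0. Proof. by rewrite mxE inord_nat. Qed.
Definition qimE := (qim0E, qim1E, qim2E).

Lemma qmulA p q r : qmul p (qmul q r) = qmul (qmul p q) r.
Proof. by apply: quat_eq; rewrite !qmulE; ring. Qed.

Lemma qmulDl p q r : qmul (p + q) r = qmul p r + qmul q r.
Proof. by apply: quat_eq; rewrite ?(qmulE, mxE); rewrite /=; ring. Qed.

Lemma qmulDr p q r : qmul p (q + r) = qmul p q + qmul p r.
Proof. by apply: quat_eq; rewrite ?mxE /=; ring. Qed.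

Lemma qmul1q p : qmul qone p = p.
Proof. by apply: quat_eq; rewrite !qmulE !qoneE; ring. Qed.

Lemma qmulq1 p : qmul p qone = p.
Proof. by apply: quat_eq; rewrite !qmulE !qoneE; ring. Qed.

Lemma qconjM p q : qconj (qmul p q) = qmul (qconj q) (qconj p).
Proof. by apply: quat_eq; rewrite ?qconjE !qmulE !qconjE; ring. Qed.

Lemma qmulZl (c : R) p q : qmul (c *: p) q = c *: qmul p q.
Proof. by apply: quat_eq; rewrite ?mxE /=; ring. Qed.

Lemma qmulZr (c : R) p q : qmul p (c *: q) = c *: qmul p q.
Proof. by apply: quat_eq; rewrite ?mxE /=; ring. Qed.

Lemma qconjD p q : qconj (p + q) = qconj p + qconj q.
Proof. by apply: quat_eq; rewrite ?mxE /=; ring. Qed.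

Definition qdot p q : R :=
  p 0 0 * q 0 0 + p 1 0 * q 1 0 + p 2%:R 0 * q 2%:R 0 + p 3%:R 0 * q 3%:R 0.

Lemma qmul_conj p : qmul p (qconj p) = qdot p p *: qone.
Proof.
by apply: quat_eq; rewrite qmulE !qconjE [RHS]mxE ?qoneE /qdot; ring.
Qed.

Lemma qconj_mul p : qmul (qconj p) p = qdot p p *: qone.
Proof.
by apply: quat_eq; rewrite qmulE !qconjE [RHS]mxE ?qoneE /qdot; ring.
Qed.

Lemma qmul_conj_sym p q :
  qmul p (qconj q) + qmul q (qconj p) = (2 * qdot p q) *: qone.
Proof.
by apply: quat_eq; rewrite mxE !qmulE !qconjE [RHS]mxE ?qoneE /qdot; ring.
Qed.

Lemma prim_dq p q : prim (dq p q) = p.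
Proof.
apply/colP => i; rewrite !mxE /= inordK; last by rewrite (leq_trans (ltn_ord i)).
by rewrite ltn_ord inord_val.
Qed.

Lemma dual_dq p q : dual (dq p q) = q.
Proof.
apply/colP => i; rewrite !mxE /= inordK; last by rewrite -[8%N]/(4 + 4)%N ltn_add2r.
by rewrite ltnNge leq_addl /= addnK inord_val.
Qed.

Lemma dq_prim_dual x : dq (prim x) (dual x) = x.
Proof.
apply/colP => i; rewrite mxE; case: ltnP => i4; rewrite mxE; congr (x _ _);
  apply/val_inj => /=.
  by rewrite !inordK.
have hi : (i - 4 < 4)%N by rewrite ltn_subLR.
by rewrite (inordK hi) subnK// inordK.
Qed.

Lemma dq_inj p q p' q' : dq p q = dq p' q' -> p = p' /\ q = q'.
Proof.
move=> E; split; first by rewrite -(prim_dq p q) E prim_dq.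
by rewrite -(dual_dq p q) E dual_dq.
Qed.

Lemma dq_eq x y : prim x = prim y -> dual x = dual y -> x = y.
Proof. by move=> px dx; rewrite -(dq_prim_dual x) px dx dq_prim_dual. Qed.

Lemma primD x y : prim (x + y) = prim x + prim y.
Proof. by apply/colP => i; rewrite !mxE. Qed.
Lemma dualD x y : dual (x + y) = dual x + dual y.
Proof. by apply/colP => i; rewrite !mxE. Qed.
Lemma primN x : prim (- x) = - prim x.
Proof. by apply/colP => i; rewrite !mxE. Qed.
Lemma dualN x : dual (- x) = - dual x.
Proof. by apply/colP => i; rewrite !mxE. Qed.
Lemma primZ (c : R) x : prim (c *: x) = c *: prim x.
Proof. by apply/colP => i; rewrite !mxE. Qed.
Lemma dualZ (c : R) x : dual (c *: x) = c *: dual x.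
Proof. by apply/colP => i; rewrite !mxE. Qed.

Lemma dqmulA x y z : dqmul x (dqmul y z) = dqmul (dqmul x y) z.
Proof.
by rewrite /dqmul !prim_dq !dual_dq !qmulDr !qmulDl !qmulA addrA.
Qed.

Lemma dqmul1q x : dqmul (dqone R) x = x.
Proof.
rewrite -{2}(dq_prim_dual x) /dqmul prim_dq dual_dq -/qone !qmul1q.
by rewrite -(scale0r (0 : 'cV[R]_4)) qmulZl scale0r addr0.
Qed.

Lemma dqmulq1 x : dqmul x (dqone R) = x.
Proof.
rewrite -{2}(dq_prim_dual x) /dqmul prim_dq dual_dq -/qone !qmulq1.
by rewrite -(scale0r (0 : 'cV[R]_4)) qmulZr scale0r add0r.
Qed.

Lemma dqconjM x y : dqconj (dqmul x y) = dqmul (dqconj y) (dqconj x).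
Proof.
by rewrite /dqmul /dqconj !prim_dq !dual_dq qconjD !qconjM addrC.
Qed.

(** The product of [x] with its conjugate has real primary and dual parts: the squared norm of
    [prim x], and twice its inner product with [dual x]. *)
Lemma unit_dqP x :
  unit_dq x <-> qdot (prim x) (prim x) = 1 /\ qdot (prim x) (dual x) = 0.
Proof.
have E : dqmul x (dqconj x) =
    dq (qdot (prim x) (prim x) *: qone) ((2 * qdot (prim x) (dual x)) *: qone).
  by rewrite /dqmul /dqconj prim_dq dual_dq qmul_conj qmul_conj_sym.
rewrite /unit_dq E; split=> [/dq_inj[]|[-> ->]]; last by rewrite mulr0 scale1r scale0r.
move=> /colP/(_ 0) + /colP/(_ 0); rewrite !mxE eqxx mulr1 => ->.
by rewrite mulr1 => /eqP; rewrite mulf_eq0 pnatr_eq0/= => /eqP.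
Qed.

Lemma unit_dqM x y : unit_dq x -> unit_dq y -> unit_dq (dqmul x y).
Proof.
move=> ux uy; rewrite /unit_dq dqconjM -dqmulA [dqmul y _]dqmulA uy.
by rewrite dqmul1q.
Qed.

Lemma dqmulDl x y z : dqmul (x + y) z = dqmul x z + dqmul y z.
Proof.
apply: dq_eq; rewrite ?primD ?dualD /dqmul ?prim_dq ?dual_dq.
  by rewrite primD qmulDl.
by rewrite primD dualD !qmulDl addrACA.
Qed.

Lemma dqmulZl (c : R) x z : dqmul (c *: x) z = c *: dqmul x z.
Proof.
apply: dq_eq; rewrite ?primZ ?dualZ /dqmul ?prim_dq ?dual_dq.
  by rewrite primZ qmulZl.
by rewrite primZ dualZ !qmulZl scalerDr.
Qed.

Lemma dqmul_H8m x y : dqmul x y = H8m y *m x.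
Proof.
have E : x = \sum_i x i 0 *: delta_mx i 0.
  by rewrite {1}[x]matrix_sum_delta; apply: eq_bigr => i _; rewrite big_ord1.
have mor : {morph (fun z => dqmul z y) : u v / u + v}.
  by move=> u v; exact: dqmulDl.
rewrite {1}E (big_morph (fun z => dqmul z y) mor (_ : _ = 0)); last first.
  by have := dqmulZl 0 0 y; rewrite !scale0r.
apply/colP => i; rewrite summxE [RHS]mxE; apply: eq_bigr => j _.
by rewrite dqmulZl [LHS]mxE [H8m _ _ _]mxE mulrC.
Qed.

Lemma qmul_H4m p q : qmul p q = H4m q *m p.
Proof.
have E : p = \sum_i p i 0 *: delta_mx i 0.
  by rewrite {1}[p]matrix_sum_delta; apply: eq_bigr => i _; rewrite big_ord1.
have mor : {morph (fun u => qmul u q) : u v / u + v}.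
  by move=> u v; exact: qmulDl.
rewrite {1}E (big_morph (fun u => qmul u q) mor (_ : _ = 0)); last first.
  by have := qmulZl 0 0 q; rewrite !scale0r.
apply/colP => i; rewrite summxE [RHS]mxE; apply: eq_bigr => j _.
by rewrite qmulZl [LHS]mxE [H4m _ _ _]mxE mulrC.
Qed.

Lemma qmul_H4p p q : qmul p q = H4p p *m q.
Proof.
have E : q = \sum_i q i 0 *: delta_mx i 0.
  by rewrite {1}[q]matrix_sum_delta; apply: eq_bigr => i _; rewrite big_ord1.
have mor : {morph qmul p : u v / u + v} by move=> u v; exact: qmulDr.
rewrite {1}E (big_morph (qmul p) mor (_ : _ = 0)); last first.
  by have := qmulZr 0 p 0; rewrite !scale0r.
apply/colP => i; rewrite summxE [RHS]mxE; apply: eq_bigr => j _.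
by rewrite qmulZr [LHS]mxE [H4p _ _ _]mxE mulrC.
Qed.

Lemma dq_col_mx p q : dq p q = col_mx p q :> 'cV[R]_(4 + 4).
Proof.
apply/colP => i; rewrite [LHS]mxE; case: (splitP i) => j ij.
  rewrite ij inord_val.
  by have -> : i = lshift 4 j by [apply: ord_inj]; rewrite col_mxEu.
rewrite ij addKn inord_val.
by have -> : i = rshift 4 j by [apply: ord_inj]; rewrite col_mxEd.
Qed.

Lemma vec6_col_mx x : vec6 x = col_mx (qim (prim x)) (qim (dual x)) :> 'cV[R]_(3 + 3).
Proof.
apply/colP => i; rewrite [LHS]mxE; case: (splitP i) => j ij.
  rewrite ij inord_val.
  by have -> : i = lshift 3 j by [apply: ord_inj]; rewrite col_mxEu.
rewrite ij addKn inord_val.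
by have -> : i = rshift 3 j by [apply: ord_inj]; rewrite col_mxEd.
Qed.

Lemma pureq_col_mx (v : 'cV[R]_3) : pureq v = col_mx (0 : 'cV_1) v :> 'cV[R]_(1 + 3).
Proof.
apply/colP => i; rewrite [LHS]mxE; case: (splitP i) => j ij.
  have -> : i = lshift 3 j by apply: ord_inj.
  by rewrite col_mxEu ord1 mxE.
rewrite ij /= inord_val.
by have -> : i = rshift 1 j by [apply: ord_inj]; rewrite col_mxEd.
Qed.

(** The product rule for r + eps e r with e = p / 2: [u] moves [r] through [Qmat], which contributes
    e r' to the dual part, and [v] is the derivative of [e], multiplied by [r]. *)
Lemma Q8_mulE x (u v : 'cV[R]_3) :
  Q8 x *m (col_mx u v : 'cV[R]_(3 + 3)) =
  dq (Qmat (prim x) *m u)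
     (qmul ((1 / 2%:R) *: transl x) (Qmat (prim x) *m u) + qmul (pureq v) (prim x)).
Proof.
rewrite dq_col_mx; refine (etrans (mul_block_col (Qmat (prim x)) 0 _ _ u v) _).
rewrite mul0mx addr0; congr (col_mx _ (_ + _)).
  by rewrite qmulZl -scalemxAl qmul_H4p mulmxA.
rewrite qmul_H4m -mulmxA pureq_col_mx; congr (_ *m _).
by refine (etrans (mul_col_mx (0 : 'M[R]_(1, 3)) 1%:M v) _); rewrite mul0mx mul1mx.
Qed.

End Quaternion.

(** * Coordinatewise derivatives and limits of matrices *)

Section MatrixCalculus.
Variable R : realType.

Lemma is_derive_mx m n (V : normedModType R) (M : V -> 'M[R]_(m, n)) x v (dM : 'M[R]_(m, n)) :
  is_derive x v M dM <-> forall i j, is_derive x v (fun u => M u i j) (dM i j).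
Proof.
split=> [[exM <-] i j|hM].
  rewrite derive_mx// mxE; apply/derivableP.
  by move/derivable_mxP : exM; apply.
have exM : derivable M x v by apply/derivable_mxP => i j; have [] := hM i j.
apply: DeriveDef => //; rewrite derive_mx//; apply/matrixP => i j; rewrite mxE.
by have [_ ->] := hM i j.
Qed.

Lemma is_derive_line (V W : normedModType R) (f : V -> W) x v df :
  is_derive (0 : R) 1 (fun h : R => f (h *: v + x)) df -> is_derive x v f df.
Proof.
move=> [exf <-]; apply: DeriveDef; first exact: (proj2 (derivable1P f x v) exf).
rewrite /derive; set g1 := fun h => h^-1 *: _; set g2 := fun h => h^-1 *: _.
suff -> : g1 = g2 by [].
by apply/funext => h; rewrite /g1 /g2 /= addr0 scale0r add0r [_%:A]mulr1.
Qed.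

Lemma is_derive_inv (f : R -> R) (x df : R) : f x != 0 -> is_derive x 1 f df ->
  is_derive x 1 (fun t => (f t)^-1) (- df / f x ^+ 2).
Proof.
move=> fx0 [exf <-]; apply: DeriveDef; first exact: derivableV.
by rewrite deriveV// /GRing.scale /= mulNr mulrC mulNr.
Qed.

Lemma is_derive_sqr (f : R -> R) (x df : R) : is_derive x 1 f df ->
  is_derive x 1 (fun t => f t ^+ 2) (2 * f x * df).
Proof.
move=> hf; apply: is_derive_eq (is_derive_mul hf hf) _; ring.
Qed.

Lemma cvg_mxP m n (T : Type) (F : set_system T) (FF : Filter F)
    (f : T -> 'M[R]_(m, n)) (M : 'M[R]_(m, n)) :
  f x @[x --> F] --> M <-> forall i j, f x i j @[x --> F] --> M i j.
Proof.
split=> [fM i j|fM]; apply/cvgrPdist_le => /= e e0.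
  move/cvgrPdist_le : fM => /(_ _ e0); apply: filterS => x; apply: le_trans.
  rewrite [leRHS]/Num.Def.normr/= mx_normrE.
  by apply: le_trans; last exact: (le_bigmax _ _ (i, j)); rewrite !mxE.
near=> x.
rewrite /Num.Def.normr/= mx_normrE (bigmax_le _ (ltW e0))//= => i _.
rewrite !mxE/=; move: i; near: x; apply: filter_forall => /= i.
by have /cvgrPdist_le := fM i.1 i.2; apply.
Unshelve. all: by end_near. Qed.

Lemma sum3E (F : 'I_3 -> R) : \sum_i F i = F 0 + F 1 + F 2%:R.
Proof.
rewrite !big_ord_recl big_ord0 addr0 -addrA; congr (F _ + (F _ + F _));
  exact/val_inj.
Qed.

End MatrixCalculus.

(** * The differential of the quaternion exponential, and the logarithm along a curve *)

Section QuaternionExp.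
Variable R : realType.
Implicit Types (w z : 'cV[R]_3) (r : 'cV[R]_4).

Definition dot3 w z : R := w 0 0 * z 0 0 + w 1 0 * z 1 0 + w 2%:R 0 * z 2%:R 0.

Lemma nrm3E w : nrm3 w = Num.sqrt (dot3 w w).
Proof. by rewrite /nrm3 sum3E !expr2. Qed.

Lemma sqr_nrm3 w : nrm3 w ^+ 2 = dot3 w w.
Proof. by rewrite sqr_sqrtr ?sum3E ?expr2// !addr_ge0// sqr_ge0. Qed.

Lemma nrm3_ge0 w : 0 <= nrm3 w. Proof. exact: sqrtr_ge0. Qed.

Lemma nrm3_eq0 w : (nrm3 w == 0) = (w == 0).
Proof.
apply/eqP/eqP => [w0|->]; last first.
  by rewrite nrm3E /dot3 !mxE !mul0r !addr0 sqrtr0.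
have : dot3 w w = 0 by rewrite -sqr_nrm3 w0 expr0n.
rewrite /dot3 -!expr2 => /eqP; rewrite !paddr_eq0 ?addr_ge0 ?sqr_ge0//.
rewrite !sqrf_eq0 => /andP[/andP[/eqP h0 /eqP h1] /eqP h2].
by apply/colP; apply: ord3_cases; rewrite [RHS]mxE.
Qed.

Lemma nrm3Z (c : R) w : nrm3 (c *: w) = `|c| * nrm3 w.
Proof.
rewrite !nrm3E -sqrtr_sqr -sqrtrM ?sqr_ge0//; congr Num.sqrt.
by rewrite /dot3 !mxE; ring.
Qed.

Lemma qexp0E w : qexp w 0 0 = cos (nrm3 w). Proof. by rewrite mxE. Qed.

Lemma qexpSE w i : qexp w (lift 0 i) 0 = sin (nrm3 w) / nrm3 w * w i 0.
Proof. by rewrite mxE /= inord_val. Qed.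

Lemma nrm3_delta_line (h : R) (k : 'I_3) :
  nrm3 (h *: delta_mx k 0 + 0) = `|h|.
Proof.
rewrite addr0 nrm3Z -[RHS]mulr1; congr (_ * _).
rewrite nrm3E /dot3 !mxE; move: k; apply: ord3_cases; rewrite /=.
all: by rewrite ?eqxx/= ?(mulr0, mulr1, addr0, add0r) sqrtr1.
Qed.

Lemma ord4_lift (P : 'I_4 -> Prop) :
  P 0 -> (forall i : 'I_3, P (lift 0 i)) -> forall i, P i.
Proof. by move=> P0 P1 i; case: (unliftP 0 i) => [j|] ->. Qed.

(** The differential of [qexp] at [w] applied to [z]. The origin needs its own case: there
    [sin th / th] evaluates to 0 by the convention for division, while its limit is 1. *)
Definition dqexp w z : 'cV[R]_4 :=
  if w == 0 then pureq z else
  let th := nrm3 w in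
  \col_(i < 4) if i == 0 :> nat then - (sin th / th) * dot3 w z
    else sin th / th * z (inord i.-1) 0
         + (cos th / th ^+ 2 - sin th / th ^+ 3) * dot3 w z * w (inord i.-1) 0.

(** Basis directions suffice because [Qmat] is assembled from partial derivatives; linearity of
    [dqexp w] then extends the formula to [Qmat r *m z]. *)
Lemma dqexp_delta w (k : 'I_3) :
  is_derive w (delta_mx k 0) (@qexp R) (dqexp w (delta_mx k 0)).
Proof.
apply/is_derive_mx => i j; rewrite ord1 {j}; apply: is_derive_line => /=.
rewrite /dqexp; have [->|wn0] := eqVneq w 0.
  move: i; apply: ord4_lift => [|i].
    rewrite pureq0E.
    under eq_fun do rewrite qexp0E nrm3_delta_line cos_norm.
    by apply: is_derive_eq (is_derive_cos 0) _; rewrite sin0 oppr0.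
  under eq_fun do rewrite qexpSE nrm3_delta_line addr0 !mxE.
  rewrite mxE /= inord_val mxE eqxx andbT.
  (* At [h = 0] both sides vanish whatever the value of the quotient; elsewhere the signs cancel
     because sine is odd. *)
  have -> : (fun h : R => sin `|h| / `|h| * (h * (i == k)%:R)) =
            (fun h : R => (i == k)%:R * sin h).
    apply/funext => h; have [->|h0] := eqVneq h 0.
      by rewrite sin0 mul0r !mulr0.
    have [hp|hn] := ltP 0 h; first by rewrite gtr0_norm//; field.
    by rewrite ler0_norm// sinN; field.
  by apply: is_derive_eq (is_derive_mulC _ (is_derive_sin 0)) _; rewrite cos0 mulr1.
set th := nrm3 w.
have th0 : th != 0 by rewrite nrm3_eq0.
have thp : 0 < th by rewrite lt0r th0 nrm3_ge0.
have line0 : (0 : R) *: delta_mx k 0 + w = w by rewrite scale0r add0r.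
have dotk : dot3 w (delta_mx k 0) = w k 0.
  rewrite /dot3 !mxE; move: k {line0}; apply: ord3_cases => /=;
  by rewrite ?eqxx/= ?(mulr0, mulr1, addr0, add0r).
have hcoord m : is_derive (0 : R) 1 (fun h : R => (h *: delta_mx k 0 + w) m 0)
    ((delta_mx k 0 : 'cV[R]_3) m 0).
  under eq_fun do rewrite mxE [X in X + _]mxE mulrC.
  apply: is_derive_eq (is_derive_add (is_derive_mulC _ (is_derive_id (0 : R) 1))
    (is_derive_const _ _)) _.
  by rewrite mulr1 addr0.
have hnrm : is_derive (0 : R) 1 (fun h : R => nrm3 (h *: delta_mx k 0 + w)) (w k 0 / th).
  under eq_fun do rewrite nrm3E.
  have hd : is_derive (0 : R) 1 (fun h : R => dot3 (h *: delta_mx k 0 + w) (h *: delta_mx k 0 + w))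
     (2 * w k 0).
    apply: is_derive_eq (is_derive_add (is_derive_add
      (is_derive_mul (hcoord 0) (hcoord 0)) (is_derive_mul (hcoord 1) (hcoord 1)))
      (is_derive_mul (hcoord 2%:R) (hcoord 2%:R))) _.
    by rewrite line0 -dotk /dot3; ring.
  have dp : 0 < dot3 (0 *: delta_mx k 0 + w) (0 *: delta_mx k 0 + w).
    by rewrite line0 -sqr_nrm3 exprn_gt0.
  pose g := fun h : R => dot3 (h *: delta_mx k 0 + w) (h *: delta_mx k 0 + w).
  have hs : is_derive (g 0) 1 (@Num.sqrt R) (2 * Num.sqrt (g 0))^-1 := is_derive1_sqrt dp.
  apply: is_derive_eq (is_derive_compose hs hd) _.
  by rewrite /g line0 -nrm3E -/th; field.
move: i; apply: ord4_lift => [|i].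
  under eq_fun do rewrite qexp0E.
  apply: is_derive_eq (is_derive_compose (is_derive_cos _) hnrm) _.
  by rewrite line0 -/th mxE /= dotk; ring.
under eq_fun do rewrite qexpSE.
have nz : nrm3 (0 *: delta_mx k 0 + w) != 0 by rewrite line0.
pose g := fun h : R => nrm3 (h *: delta_mx k 0 + w).
have hinv := @is_derive_inv R g 0 _ nz hnrm.
have hsin := is_derive_compose (is_derive_sin (g 0)) hnrm.
apply: is_derive_eq (is_derive_mul (is_derive_mul hsin hinv) (hcoord i)) _.
by rewrite /g line0 -/th [RHS]mxE /= inord_val dotk; field.
Qed.

Lemma dqexpD w : {morph dqexp w : z z' / z + z'}.
Proof.
move=> z z'; rewrite /dqexp; case: ifP => _; apply/colP => i; rewrite !mxE /dot3 ?mxE;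
  case: ifP => _ //; rewrite ?addr0//; ring.
Qed.

Lemma dqexpZ w (c : R) z : dqexp w (c *: z) = c *: dqexp w z.
Proof.
rewrite /dqexp; case: ifP => _; apply/colP => i; rewrite !mxE /dot3 ?mxE;
  case: ifP => _ //; rewrite ?mulr0//; ring.
Qed.

Lemma Qmat_mulE r z : Qmat r *m z = dqexp (qlog3 r) z.
Proof.
have E : z = \sum_i z i 0 *: delta_mx i 0.
  by rewrite {1}[z]matrix_sum_delta; apply: eq_bigr => i _; rewrite big_ord1.
rewrite {2}E (big_morph _ (dqexpD (qlog3 r)) (_ : _ = 0)); last first.
  by have := dqexpZ (qlog3 r) 0 0; rewrite !scale0r.
apply/colP => i; rewrite summxE [LHS]mxE; apply: eq_bigr => k _.
rewrite dqexpZ [RHS]mxE [Qmat _ _ _]mxE mulrC; congr (_ * _).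
by have [_ ->] := dqexp_delta (qlog3 r) k.
Qed.

Lemma dqexp0E w z : w != 0 -> dqexp w z 0 0 = - (sin (nrm3 w) / nrm3 w) * dot3 w z.
Proof. by move=> wn0; rewrite /dqexp (negPf wn0) mxE. Qed.

Lemma dqexpSE w z i : w != 0 -> dqexp w z (lift 0 i) 0 =
  sin (nrm3 w) / nrm3 w * z i 0 +
  (cos (nrm3 w) / nrm3 w ^+ 2 - sin (nrm3 w) / nrm3 w ^+ 3) * dot3 w z * w i 0.
Proof. by move=> wn0; rewrite /dqexp (negPf wn0) mxE /= inord_val. Qed.

(** [qexp] takes values in the unit sphere, so its differential is tangent to it. This removes the
    rotation from the equation of the translation. *)
Lemma qdot_dqexp w z : qdot (qexp w) (dqexp w z) = 0.
Proof.
have i1 : (1 : 'I_4) = lift 0 (0 : 'I_3) by apply/val_inj.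
have i2 : (2%:R : 'I_4) = lift 0 (1 : 'I_3) by apply/val_inj.
have i3 : (3%:R : 'I_4) = lift 0 (2%:R : 'I_3) by apply/val_inj.
rewrite /qdot; have [->|wn0] := eqVneq w 0.
  rewrite /dqexp eqxx.
  by rewrite !pureqE i3 i2 i1 !qexpSE !mxE !(mulr0, mul0r, addr0).
rewrite i3 i2 i1 !qexpSE qexp0E !dqexpSE// dqexp0E//.
have th0 : nrm3 w != 0 by rewrite nrm3_eq0.
have E : w 0 0 ^+ 2 = nrm3 w ^+ 2 - w 1 0 ^+ 2 - w 2%:R 0 ^+ 2.
  by rewrite sqr_nrm3 /dot3; ring.
by rewrite /dot3; field: E.
Qed.

(* theta / sin theta as a function of cos theta, with its limit value at 1 *)
Definition acosc (c : R) : R := if c == 1 then 1 else acos c / Num.sqrt (1 - c ^+ 2).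

Lemma qdot1_range r : qdot r r = 1 -> -1 <= r 0 0 <= 1.
Proof.
move=> r1; rewrite -ler_norml -(@ler_pXn2r _ 2)// ?nnegrE// expr1n real_normK ?num_real//.
by rewrite -r1 /qdot -!expr2 -!addrA lerDl !addr_ge0// sqr_ge0.
Qed.

Lemma nrm3_qim r : qdot r r = 1 -> nrm3 (qim r) = Num.sqrt (1 - r 0 0 ^+ 2).
Proof.
by move=> r1; rewrite nrm3E -r1 /dot3 /qdot !qimE; congr Num.sqrt; ring.
Qed.

Lemma qim_eq0 r : qdot r r = 1 -> r 0 0 = 1 -> qim r = 0.
Proof.
by move=> r1 r01; apply/eqP; rewrite -nrm3_eq0 nrm3_qim// r01 expr1n subrr sqrtr0.
Qed.

(** The form suited to differentiation: a scalar function of the real part times a linear map. At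
    [r = 1] the default value of the axis is harmless since [qim r] vanishes. *)
Lemma qlog3E r : qdot r r = 1 -> qlog3 r = acosc (r 0 0) *: qim r.
Proof.
move=> r1; rewrite /acosc; case: eqVneq => [r01|rn1].
  by rewrite /qlog3 /raxis (qim_eq0 r1 r01) !scaler0.
rewrite /qlog3 /raxis nrm3_qim// scalerA; congr (_ / _ *: _).
by rewrite /rphi; field.
Qed.

Lemma qim_lift r i : qim r i 0 = r (lift 0 i) 0.
Proof.
rewrite mxE; congr (r _ _); apply/val_inj.
by rewrite /= inordK// ltnS ltn_ord.
Qed.

Section UnitQuaternion.
Variable r : 'cV[R]_4.
Hypotheses (r1 : qdot r r = 1) (r_neqN1 : r 0 0 <> -1) (r_neq1 : r 0 0 != 1).

Lemma unit_quat_range : -1 < r 0 0 < 1.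
Proof.
have /andP[rl ru] := qdot1_range r1.
by rewrite !lt_neqAle rl ru r_neq1 andbT eq_sym; apply/andP; split=> //; apply/eqP.
Qed.

Lemma sin_angle_gt0 : 0 < Num.sqrt (1 - r 0 0 ^+ 2).
Proof.
have /andP[rl ru] := unit_quat_range; rewrite sqrtr_gt0.
have -> : 1 - r 0 0 ^+ 2 = (1 - r 0 0) * (1 + r 0 0) by ring.
by apply: mulr_gt0; lra.
Qed.

Lemma acos_angle_gt0 : 0 < acos (r 0 0).
Proof. by have /andP[rl ru] := unit_quat_range; rewrite acos_gt0// ltW. Qed.

Lemma nrm3_qlog3 : nrm3 (qlog3 r) = acos (r 0 0).
Proof.
rewrite qlog3E// nrm3Z nrm3_qim// /acosc (negPf r_neq1) ger0_norm.
  by rewrite divfK// gt_eqF// sin_angle_gt0.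
by rewrite divr_ge0// ltW// ?acos_angle_gt0 ?sin_angle_gt0.
Qed.

End UnitQuaternion.

(** At -1 the identity fails: the axis defaults to 0, and [qexp] would return 1. *)
Lemma qexp_qlog3 r : qdot r r = 1 -> r 0 0 <> -1 -> qexp (qlog3 r) = r.
Proof.
move=> r1 rN1; have ra := qdot1_range r1.
apply/colP; have [r01|rn1] := eqVneq (r 0 0) 1.
  have w0 : qlog3 r = 0 by rewrite qlog3E// (qim_eq0 r1 r01) scaler0.
  have n0 : nrm3 (qlog3 r) = 0 by apply/eqP; rewrite nrm3_eq0 w0.
  apply: ord4_lift => [|i]; first by rewrite qexp0E n0 cos0.
  by rewrite qexpSE -qim_lift (qim_eq0 r1 r01) w0 !mxE mulr0.
have s0 := sin_angle_gt0 r1 rN1 rn1; have a0 := acos_angle_gt0 r1 rN1 rn1.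
apply: ord4_lift => [|i].
  by rewrite qexp0E nrm3_qlog3// acosK// in_itv.
rewrite qexpSE nrm3_qlog3// sin_acos// qlog3E// mxE -qim_lift /acosc (negPf rn1).
by field; rewrite !gt_eqF.
Qed.

Lemma norm_sin_le (x : R) : 0 <= x -> `|sin x| <= x.
Proof.
move=> x0; have [|c] := @MVT_segment R _ _ 0 x x0 (fun t _ => is_derive_sin t).
  by apply: is_derive_within_continuous => t _; exact: is_derive_sin.
rewrite in_itv/= sin0 !subr0 => _ ->.
by rewrite normrM [`|x|]ger0_norm// -[leRHS]mul1r ler_wpM2r// cos_max.
Qed.

(** The lower bound holds because sin t - t cos t vanishes at 0 and has derivative t sin t,
    nonnegative on this interval. *)
Lemma sin_mul_bounds (x : R) : 0 <= x <= pi / 2 -> x * cos x <= sin x <= x.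
Proof.
move=> /andP[x0 xp]; apply/andP; split.
  have hd (t : R) : is_derive t 1 (fun t => sin t - t * cos t) (t * sin t).
    apply: is_derive_eq (is_derive_sub (is_derive_sin t)
      (is_derive_mul (is_derive_id t 1) (is_derive_cos t))) _.
    by ring.
  have [|c] := @MVT_segment R _ _ 0 x x0 (fun t _ => hd t).
    by apply: is_derive_within_continuous => t _; exact: hd.
  rewrite in_itv/= sin0 mul0r !subr0 => /andP[c0 cx] E.
  rewrite -subr_ge0 E !mulr_ge0// sin_ge0_pi// c0 /=.
  by have := pi_ge0 R => p0; lra.
exact: le_trans (ler_norm _) (norm_sin_le x0).
Qed.

(** For x = acos c this inverts cos x <= sin x / x <= 1; positivity of [c] places x below pi / 2. *)
Lemma acosc_bounds (c : R) : 0 < c <= 1 -> 1 <= acosc c <= c^-1.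
Proof.
move=> /andP[c0 c1]; rewrite /acosc; case: eqVneq => [->|cn1].
  by rewrite invr1 lexx.
have clt1 : c < 1 by rewrite lt_neqAle cn1.
have cr : -1 <= c <= 1 by apply/andP; split; lra.
have ap : 0 < acos c by apply: acos_gt0; apply/andP; split; lra.
have sp : 0 < Num.sqrt (1 - c ^+ 2).
  rewrite sqrtr_gt0; have -> : 1 - c ^+ 2 = (1 - c) * (1 + c) by ring.
  by apply: mulr_gt0; lra.
have ah : acos c <= pi / 2.
  rewrite leNgt; apply/negP => hlt.
  have acp : acos c \in `[0, pi] by rewrite in_itv/= (ltW ap) acos_lepi.
  have php : (pi / 2 : R) \in `[0, pi].
    by rewrite in_itv/=; have := pi_ge0 R => p0; apply/andP; split; lra.
  have := ltr_cos php acp; rewrite hlt cos_pihalf acosK ?in_itv// => c_lt0.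
  by have := lt_trans c0 c_lt0; rewrite ltxx.
have := @sin_mul_bounds (acos c); rewrite (ltW ap) ah => /(_ isT).
rewrite acosK ?in_itv// sin_acos// => /andP[l1 l2].
by rewrite ler_pdivlMr// mul1r l2 /= ler_pdivrMr// mulrC ler_pdivlMr.
Qed.

Lemma acosc_cvg1 (T : Type) (F : set_system T) (FF : Filter F) (f : T -> R) :
  (\forall t \near F, f t <= 1) -> f t @[t --> F] --> (1 : R) ->
  acosc (f t) @[t --> F] --> (1 : R).
Proof.
move=> f1 fc.
apply: (@squeeze_cvgr _ _ _ _ (fun=> 1) (fun t => (f t)^-1)).
- near=> t; apply: acosc_bounds; apply/andP; split; last by near: t.
  by near: t; apply: cvgr_gt fc _ _.
- exact: cvg_cst.
- by rewrite -[X in _ --> X]invr1; apply: cvgV.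
Unshelve. all: by end_near. Qed.

Lemma is_derive_acosc (c : R) : -1 < c < 1 ->
  let s := Num.sqrt (1 - c ^+ 2) in
  is_derive c 1 acosc ((-1 + acos c * c / s) / s ^+ 2).
Proof.
move=> cr s; have /andP[cl cu] := cr.
have dp : 0 < 1 - c ^+ 2.
  have -> : 1 - c ^+ 2 = (1 - c) * (1 + c) by ring.
  by apply: mulr_gt0; lra.
have sp : 0 < s by rewrite sqrtr_gt0.
have near1 : \forall x \near c, acos x / Num.sqrt (1 - x ^+ 2) = acosc x.
  near=> x; rewrite /acosc lt_eqF//.
  by near: x; exact: lt_nbhsl.
apply: near_eq_is_derive near1 _.
have hq : is_derive c 1 (fun x => 1 - x ^+ 2) (- (2 * c)).
  apply: is_derive_eq (is_derive_sub (is_derive_const 1 c)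
    (is_derive_sqr (is_derive_id c 1))) _; ring.
have hs0 : is_derive (1 - c ^+ 2) 1 (@Num.sqrt R) (2 * s)^-1 := is_derive1_sqrt dp.
have hs := @is_derive_compose R Num.sqrt (fun x => 1 - x ^+ 2) c _ _ hs0 hq.
have s0 : s != 0 by rewrite gt_eqF.
have hi := @is_derive_inv R (fun x => Num.sqrt (1 - x ^+ 2)) c _ s0 hs.
apply: is_derive_eq (is_derive_mul (is_derive1_acos cr) hi) _.
by rewrite -/s; field.
Unshelve. all: by end_near. Qed.

(* acosc is not differentiable at c = 1 (acos is junk beyond 1), but there the imaginary
   part vanishes, and continuity of acosc suffices (Caratheodory's criterion). *)
Lemma is_derive_qlog3 (r : R -> 'cV[R]_4) (t0 : R) z :
  (\forall t \near t0, qdot (r t) (r t) = 1) -> r t0 0 0 <> -1 ->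
  (forall i, is_derive t0 1 (fun t => r t i 0) (dqexp (qlog3 (r t0)) z i 0)) ->
  forall k, is_derive t0 1 (fun t => qlog3 (r t) k 0) (z k 0).
Proof.
move=> rn rN1 hr k.
have r1 : qdot (r t0) (r t0) = 1 by apply: nbhs_singleton rn.
have nE : \forall t \near t0, acosc (r t 0 0) * qim (r t) k 0 = qlog3 (r t) k 0.
  by near=> t; rewrite qlog3E ?mxE//; near: t.
apply: near_eq_is_derive nE _.
have hv : is_derive t0 1 (fun t => qim (r t) k 0) (dqexp (qlog3 (r t0)) z (lift 0 k) 0).
  by under eq_fun do rewrite qim_lift; exact: hr.
have hr0 := hr 0.
have [r01|rn1] := eqVneq (r t0 0 0) 1.
  have v0 : qim (r t0) = 0 by exact: qim_eq0.
  have w0 : qlog3 (r t0) = 0 by rewrite qlog3E// v0 scaler0.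
  have /is_derive1_caratheodory[g [gE gc g0]] := hv.
  apply/is_derive1_caratheodory; exists (fun t => acosc (r t 0 0) * g t); split.
  - have v0k : qim (r t0) k 0 = 0 by rewrite v0 mxE.
    by move=> t; move: (gE t); rewrite v0k mulr0 !subr0 => ->; rewrite mulrA.
  - apply: cvgM => //; rewrite r01 /acosc eqxx; apply: acosc_cvg1.
      near=> t; have /qdot1_range/andP[] : qdot (r t) (r t) = 1 by near: t.
      by [].
    by rewrite -r01; exact: is_derive_continuous hr0.
  - by rewrite r01 /acosc eqxx mul1r g0 w0 /dqexp eqxx mxE /= inord_val.
have cr := unit_quat_range r1 rN1 rn1.
have sp := sin_angle_gt0 r1 rN1 rn1; have ap := acos_angle_gt0 r1 rN1 rn1.
apply: is_derive_eq (is_derive_mul (is_derive_compose (is_derive_acosc cr) hr0) hv) _.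
have wn0 : qlog3 (r t0) != 0 by rewrite -nrm3_eq0 nrm3_qlog3// gt_eqF.
rewrite dqexp0E// dqexpSE// nrm3_qlog3// sin_acos ?qdot1_range// acosK; last first.
  by rewrite in_itv/= qdot1_range.
have -> : qlog3 (r t0) k 0 = acosc (r t0 0 0) * qim (r t0) k 0 by rewrite qlog3E// mxE.
rewrite /acosc (negPf rn1); set d := dot3 _ _.
by field; rewrite !gt_eqF.
Unshelve. all: by end_near. Qed.

End QuaternionExp.

(** * Limits of quaternion expressions and continuity of the exponential *)

Section Limits.
Variables (R : realType) (T : Type) (F : set_system T).
Context {FF : ProperFilter F}.

Implicit Types (f g : T -> R) (p q : R).

Lemma cvg_add f g p q : f t @[t --> F] --> p -> g t @[t --> F] --> q ->
  f t + g t @[t --> F] --> p + q.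
Proof. exact: cvgD. Qed.

Lemma cvg_sub f g p q : f t @[t --> F] --> p -> g t @[t --> F] --> q ->
  f t - g t @[t --> F] --> p - q.
Proof. exact: cvgB. Qed.

Lemma cvg_mul f g p q : f t @[t --> F] --> p -> g t @[t --> F] --> q ->
  f t * g t @[t --> F] --> p * q.
Proof. exact: cvgM. Qed.

Lemma qmul_cvg (f g : T -> 'cV[R]_4) (p q : 'cV[R]_4) :
  f t @[t --> F] --> p -> g t @[t --> F] --> q ->
  qmul (f t) (g t) @[t --> F] --> qmul p q.
Proof.
move=> /cvg_mxP fp /cvg_mxP gq; apply/cvg_mxP => i j; rewrite ord1 {j}; move: i.
apply: ord4_cases.
all: rewrite qmulE; under eq_fun do rewrite qmulE.
all: have M k l := cvg_mul (fp k 0) (gq l 0).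
- exact: cvg_sub (cvg_sub (cvg_sub (M 0 0) (M 1 1)) (M 2%:R 2%:R)) (M 3%:R 3%:R).
- exact: cvg_sub (cvg_add (cvg_add (M 0 1) (M 1 0)) (M 2%:R 3%:R)) (M 3%:R 2%:R).
- exact: cvg_add (cvg_add (cvg_sub (M 0 2%:R) (M 1 3%:R)) (M 2%:R 0)) (M 3%:R 1).
- exact: cvg_add (cvg_sub (cvg_add (M 0 3%:R) (M 1 2%:R)) (M 2%:R 1)) (M 3%:R 0).
Qed.

Lemma dq_cvg (f g : T -> 'cV[R]_4) (p q : 'cV[R]_4) :
  f t @[t --> F] --> p -> g t @[t --> F] --> q -> dq (f t) (g t) @[t --> F] --> dq p q.
Proof.
move=> /cvg_mxP fp /cvg_mxP gq; apply/cvg_mxP => i j; rewrite mxE.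
under eq_fun do rewrite mxE; case: ifP => _; by [apply: fp|apply: gq].
Qed.

Lemma pureq_cvg (f : T -> 'cV[R]_3) (v : 'cV[R]_3) :
  f t @[t --> F] --> v -> pureq (f t) @[t --> F] --> pureq v.
Proof.
move=> /cvg_mxP fv; apply/cvg_mxP => i j; rewrite mxE.
under eq_fun do rewrite mxE; case: ifP => _; by [apply: cvg_cst|apply: fv].
Qed.

Lemma nrm3_cvg (f : T -> 'cV[R]_3) (v : 'cV[R]_3) :
  f t @[t --> F] --> v -> nrm3 (f t) @[t --> F] --> nrm3 v.
Proof.
move=> /cvg_mxP fv; under eq_fun do rewrite nrm3E; rewrite nrm3E.
have M k := cvg_mul (fv k 0) (fv k 0).
by apply: (continuous_cvg _ (@sqrt_continuous R _)); exact: cvg_add (cvg_add (M 0) (M 1)) (M 2%:R).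
Qed.

(** Only the origin is delicate: there the quotient of sine and norm takes the default value 0 and
    is discontinuous, but it is bounded by 1 and multiplied by a coordinate tending to 0. *)
Lemma qexp_cvg (f : T -> 'cV[R]_3) (v : 'cV[R]_3) :
  f t @[t --> F] --> v -> qexp (f t) @[t --> F] --> qexp v.
Proof.
move=> fv; have nf := nrm3_cvg fv; move/cvg_mxP : (fv) => fve.
apply/cvg_mxP => i j; rewrite ord1 {j}; move: i; apply: ord4_lift => [|i].
  under eq_fun do rewrite qexp0E; rewrite qexp0E.
  by apply: continuous_cvg => //; exact: continuous_cos.
under eq_fun do rewrite qexpSE; rewrite qexpSE.
have [v0|vn0] := eqVneq v 0; last first.
  apply: cvgM; last exact: fve.
  apply: cvgM; last by apply: cvgV => //; rewrite nrm3_eq0.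
  by apply: continuous_cvg => //; exact: continuous_sin.
have fi := fve i 0; rewrite v0 mxE mulr0.
rewrite v0 mxE in fi.
have sinc_le (x : R) : 0 <= x -> `|sin x / x| <= 1.
  move=> x0; have [->|xn0] := eqVneq x 0; first by rewrite invr0 mulr0 normr0.
  have xp : 0 < x by rewrite lt0r xn0.
  rewrite normrM normfV [`|x|]gtr0_norm// ler_pdivrMr// mul1r.
  exact: norm_sin_le.
apply: norm_cvg0; apply: (@squeeze_cvgr _ _ _ _ (fun=> 0) (fun t => `|f t i 0|)).
- near=> t; rewrite normr_ge0 normrM /= -[leRHS]mul1r ler_wpM2r//.
  exact/sinc_le/nrm3_ge0.
- exact: cvg_cst.
- by rewrite -(normr0 R); apply: cvg_norm.
Unshelve. all: by end_near. Qed.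

End Limits.

(** * Derivatives of quaternion-valued curves *)

Section QuaternionDerivatives.
Variable R : realType.

Lemma is_derive_qmul (f g : R -> 'cV[R]_4) (t : R) df dg :
  is_derive t 1 f df -> is_derive t 1 g dg ->
  is_derive t 1 (fun t => qmul (f t) (g t)) (qmul df (g t) + qmul (f t) dg).
Proof.
move=> /is_derive_mx hf /is_derive_mx hg; apply/is_derive_mx => i j.
rewrite ord1 {j}; move: i; apply: ord4_cases.
all: under eq_fun do rewrite qmulE; rewrite mxE !qmulE.
all: have M k l := is_derive_mul (hf k 0) (hg l 0).
- apply: is_derive_eq (is_derive_sub (is_derive_sub (is_derive_sub (M 0 0) (M 1 1))
    (M 2%:R 2%:R)) (M 3%:R 3%:R)) _; ring.
- apply: is_derive_eq (is_derive_sub (is_derive_add (is_derive_add (M 0 1) (M 1 0))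
    (M 2%:R 3%:R)) (M 3%:R 2%:R)) _; ring.
- apply: is_derive_eq (is_derive_add (is_derive_add (is_derive_sub (M 0 2%:R) (M 1 3%:R))
    (M 2%:R 0)) (M 3%:R 1)) _; ring.
- apply: is_derive_eq (is_derive_add (is_derive_sub (is_derive_add (M 0 3%:R) (M 1 2%:R))
    (M 2%:R 1)) (M 3%:R 0)) _; ring.
Qed.

Lemma is_derive_qconj (f : R -> 'cV[R]_4) (t : R) df :
  is_derive t 1 f df -> is_derive t 1 (fun t => qconj (f t)) (qconj df).
Proof.
move=> /is_derive_mx hf; apply/is_derive_mx => i j; rewrite mxE ord1.
under eq_fun do rewrite mxE; case: ifP => _; first exact: hf.
exact: is_derive_opp.
Qed.

Lemma is_derive_mulmx m n (A : 'M[R]_(m, n)) (f : R -> 'cV[R]_n) (t : R) df :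
  is_derive t 1 f df -> is_derive t 1 (fun t => A *m f t) (A *m df).
Proof.
move=> /is_derive_mx hf; apply/is_derive_mx => i j; rewrite mxE.
under eq_fun do rewrite mxE.
by apply: is_derive_bigsum => k; apply: is_derive_mulC.
Qed.

Lemma is_derive_prim (f : R -> 'cV[R]_8) (t : R) df :
  is_derive t 1 f df -> is_derive t 1 (fun t => prim (f t)) (prim df).
Proof.
move=> /is_derive_mx hf; apply/is_derive_mx => i j; rewrite mxE.
by under eq_fun do rewrite mxE; exact: hf.
Qed.

Lemma is_derive_dual (f : R -> 'cV[R]_8) (t : R) df :
  is_derive t 1 f df -> is_derive t 1 (fun t => dual (f t)) (dual df).
Proof.
move=> /is_derive_mx hf; apply/is_derive_mx => i j; rewrite mxE.
by under eq_fun do rewrite mxE; exact: hf.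
Qed.

End QuaternionDerivatives.

(** * The closed loop in logarithmic coordinates, and the two implications *)

Section Formation.
Variables (R : realType) (n : nat) (a : 'I_n -> 'I_n -> R).
Variable delta : 'I_n -> 'cV[R]_8.
Hypothesis hdelta : forall i, unit_dq (delta i).
Implicit Types (X : 'cV[R]_8) (x : 'I_n -> R -> 'cV[R]_8).

(** The dual part of the logarithm; for a unit [X] it is the factor e in X = r + eps e r. *)
Definition half_transl X : 'cV[R]_4 := (1 / 2%:R) *: transl X.

Lemma half_translE X : half_transl X = qmul (dual X) (qconj (prim X)).
Proof. by rewrite /half_transl scalerA mul1r mulVf ?pnatr_eq0// scale1r. Qed.

Lemma half_transl_real X : unit_dq X -> half_transl X 0 0 = 0.
Proof.
move=> /unit_dqP[_ r0]; rewrite half_translE qmulE !qconjE -r0 /qdot; ring.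
Qed.

Lemma dual_half_transl X : unit_dq X -> dual X = qmul (half_transl X) (prim X).
Proof.
by move=> /unit_dqP[r1 _]; rewrite half_translE -qmulA qconj_mul r1 scale1r qmulq1.
Qed.

Lemma pureq_qim (p : 'cV[R]_4) : p 0 0 = 0 -> pureq (qim p) = p.
Proof. by move=> p0; apply: quat_eq; rewrite !pureqE ?qimE. Qed.

Lemma qimB (p q : 'cV[R]_4) k : qim (p - q) k 0 = qim p k 0 - qim q k 0.
Proof. by rewrite !mxE. Qed.

Lemma qim_pureq (v : 'cV[R]_3) : qim (pureq v) = v.
Proof. by apply/colP; apply: ord3_cases; rewrite qimE pureqE. Qed.

(** Writes a pose as a continuous function of its logarithmic coordinates, through which their
    convergence passes to the pose. *)
Lemma log_dom_exp X : log_dom X -> X =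
  dq (qexp (qlog3 (prim X)))
     (qmul (pureq (qim (half_transl X))) (qexp (qlog3 (prim X)))).
Proof.
move=> [uX XN1]; have /unit_dqP[r1 _] := uX.
rewrite qexp_qlog3// pureq_qim ?half_transl_real// -dual_half_transl//.
by rewrite dq_prim_dual.
Qed.

Lemma vec6_lshift X k : vec6 X (lshift 3 k : 'I_(3 + 3)) 0 = qim (prim X) k 0.
Proof. by have /colP/(_ (lshift 3 k)) := vec6_col_mx X; rewrite col_mxEu. Qed.

Lemma vec6_rshift X k : vec6 X (rshift 3 k : 'I_(3 + 3)) 0 = qim (dual X) k 0.
Proof. by have /colP/(_ (rshift 3 k)) := vec6_col_mx X; rewrite col_mxEd. Qed.

Lemma log_disagreementE (X : 'I_n -> 'cV[R]_8) i :
  \sum_j a i j *: vec6 (dqlog (X i) - dqlog (X j)) =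
  col_mx (\col_k \sum_j a i j * (qlog3 (prim (X i)) k 0 - qlog3 (prim (X j)) k 0))
         (\col_k \sum_j a i j * (qim (half_transl (X i)) k 0 - qim (half_transl (X j)) k 0))
  :> 'cV[R]_(3 + 3).
Proof.
apply/colP => l; rewrite summxE; case: (splitP l) => k lk.
  have -> : l = lshift 3 k by apply: ord_inj.
  rewrite col_mxEu [RHS]mxE; apply: eq_bigr => j _; rewrite [LHS]mxE; congr (_ * _).
  apply: etrans (vec6_lshift _ _) _.
  by rewrite primD primN qimB !prim_dq !qim_pureq.
have -> : l = rshift 3 k by apply: ord_inj.
rewrite col_mxEd [RHS]mxE; apply: eq_bigr => j _; rewrite [LHS]mxE; congr (_ * _).
apply: etrans (vec6_rshift _ _) _.
by rewrite dualD dualN qimB !dual_dq.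
Qed.

Section Solution.
Variable x : 'I_n -> R -> 'cV[R]_8.
Hypothesis hx : is_solution a delta x.
Local Notation X := (xcen delta x).
Local Notation W := (fun k i t => qlog3 (prim (X i t)) k 0).
Local Notation E := (fun k i t => qim (half_transl (X i t)) k 0).

Definition rot_input i t : 'cV[R]_3 := \col_k \sum_j a i j * (W k i t - W k j t).
Definition tr_input i t : 'cV[R]_3 := \col_k \sum_j a i j * (E k i t - E k j t).

Lemma is_derive_xcen i (t : R) : 0 <= t -> is_derive t 1 (X i)
  (- dq (dqexp (qlog3 (prim (X i t))) (rot_input i t))
     (qmul (half_transl (X i t)) (dqexp (qlog3 (prim (X i t))) (rot_input i t))
      + qmul (pureq (tr_input i t)) (prim (X i t)))).
Proof.
move=> t0; have [_ _ dx] := hx i t0; rewrite derive1E => Dx.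
have hd : is_derive t 1 (x i) (- (H8m (delta i) *m Q8 (X i t) *m
             \sum_(j < n) a i j *: vec6 (dqlog (X i t) - dqlog (X j t)))).
  exact: DeriveDef.
have XE : (fun t => H8m (dqconj (delta i)) *m x i t) = X i.
  by apply/funext => u; rewrite -dqmul_H8m.
have := is_derive_mulmx (H8m (dqconj (delta i))) hd; rewrite XE => hX.
apply: is_derive_eq hX _.
rewrite mulmxN -[H8m (delta i) *m _ *m _]mulmxA; congr (- _).
rewrite -(dqmul_H8m _ (delta i)) -(dqmul_H8m _ (dqconj (delta i))).
rewrite -dqmulA hdelta dqmulq1.
have := log_disagreementE (fun j => X j t) i => /= ->.
by rewrite Q8_mulE Qmat_mulE.
Qed.

Lemma rot_flow k : laplacian_flow a (W k).
Proof.
move=> i t t0.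
have hX := is_derive_xcen i (ltW t0).
have uX (s : R) : 0 < s -> qdot (prim (X i s)) (prim (X i s)) = 1.
  by move=> s0; have [_ [/unit_dqP[]]] := hx i (ltW s0).
have [_ [_ XN1] _ _] := hx i (ltW t0).
have near_unit : \forall s \near t, qdot (prim (X i s)) (prim (X i s)) = 1.
  by near=> s; apply: uX; near: s; exact: lt_nbhsr.
have hprim l : is_derive t 1 (fun t => prim (X i t) l 0)
    (dqexp (qlog3 (prim (X i t))) (- rot_input i t) l 0).
  have /is_derive_mx/(_ l 0) := is_derive_prim hX.
  by rewrite primN prim_dq -scaleN1r -dqexpZ scaleN1r.
apply: is_derive_eq (is_derive_qlog3 near_unit XN1 hprim k) _.
by rewrite [LHS]mxE; congr (- _); rewrite [LHS]mxE.
Unshelve. all: by end_near. Qed.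

(** Write e for the half translation, -rho for the derivative of r, and V for the translational
    input. Differentiating the dual part times the conjugate of r gives -V, minus e times the sum of
    r conj(rho) and rho conj(r). That sum is twice the inner product of r and rho, which is zero by
    tangency. *)
Lemma tr_flow k : laplacian_flow a (E k).
Proof.
move=> i t t0.
have hX := is_derive_xcen i (ltW t0).
have [_ [uX XN1] _ _] := hx i (ltW t0).
have /unit_dqP[r1 _] := uX.
have he := is_derive_qmul (is_derive_dual hX) (is_derive_qconj (is_derive_prim hX)).
have -> : E k i = fun t => qmul (dual (X i t)) (qconj (prim (X i t))) (lift 0 k) 0.
  by apply/funext => s; rewrite qim_lift half_translE.
have /is_derive_mx/(_ (lift 0 k) 0) he' := he.
apply: is_derive_eq he' _.
rewrite dualN dual_dq primN prim_dq.
set rho := dqexp _ _; set e := half_transl _; set V := pureq _; set r := prim _.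
have rho0 : qdot r rho = 0.
  by rewrite -[r in qdot r _]qexp_qlog3// qdot_dqexp.
rewrite [in X in _ + X]dual_half_transl// -/e -/r.
have -> : qmul (- (qmul e rho + qmul V r)) (qconj r) + qmul (qmul e r) (qconj (- rho)) = - V.
  have -> : qconj (- rho) = - qconj rho.
    by apply/colP => l; rewrite !mxE; case: ifP.
  rewrite -[- (_ + _)]scaleN1r qmulZl -[- qconj rho]scaleN1r qmulZr -scalerDr scaleN1r.
  congr (- _); rewrite qmulDl -!qmulA addrAC -qmulDr addrC.
  rewrite qmul_conj r1 scale1r qmulq1 [X in qmul e X]addrC qmul_conj_sym rho0.
  by rewrite mulr0 scale0r -(scale0r (0 : 'cV[R]_4)) qmulZr scale0r addr0.
by rewrite [LHS]mxE; congr (- _); rewrite /V -qim_lift qim_pureq [LHS]mxE.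
Qed.

End Solution.

Hypothesis a_ge0 : forall i j, 0 <= a i j.

Lemma spanning_tree_formation : has_spanning_tree a -> achieves_formation a delta.
Proof.
move=> tree x hx.
have cW k := laplacian_flow_consensus a_ge0 tree (rot_flow hx k).
have cE k := laplacian_flow_consensus a_ge0 tree (tr_flow hx k).
have /choice[w hw] := cW; have /choice[e he] := cE.
pose wc : 'cV[R]_3 := \col_k w k; pose ec : 'cV[R]_3 := \col_k e k.
exists (dq (qexp wc) (qmul (pureq ec) (qexp wc))) => i.
pose w_ t := qlog3 (prim (xcen delta x i t)).
pose e_ t := qim (half_transl (xcen delta x i t)).
have cw : w_ t @[t --> +oo] --> wc.
  by apply/cvg_mxP => k l; rewrite ord1 mxE; exact: hw.
have ce : e_ t @[t --> +oo] --> ec.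
  by apply/cvg_mxP => k l; rewrite ord1 mxE; exact: he.
have cX : dq (qexp (w_ t)) (qmul (pureq (e_ t)) (qexp (w_ t))) @[t --> +oo] -->
    dq (qexp wc) (qmul (pureq ec) (qexp wc)).
  by apply: dq_cvg; [|apply: qmul_cvg; [exact: pureq_cvg|]]; exact: qexp_cvg.
(* A solution is constrained only from time 0 on, so the exponential form agrees with the pose
   eventually. *)
apply: cvg_trans cX; apply: near_eq_cvg; near=> t.
rewrite -log_dom_exp//; have [|_ //] := hx i t.
by near: t; apply: nbhs_pinfty_ge; rewrite num_real.
Unshelve. all: by end_near. Qed.

Lemma qconj1 : qconj (qone R) = qone R.
Proof. by apply: quat_eq; rewrite qconjE !qoneE ?oppr0. Qed.

Lemma formation_spanning_tree : (0 < n)%N ->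
  achieves_formation a delta -> has_spanning_tree a.
Proof.
move=> n0 form; apply: contrapT => notree.
have [c [harm [i [j cij]]]] := nonconstant_harmonic a_ge0 n0 notree.
(* With identity rotation the half translation is just the dual part: the rotational disagreement
   vanishes, and each translational coordinate reduces to the harmonic condition on [c]. Real part 1
   keeps the pose in the domain of the logarithm. *)
pose X i : 'cV[R]_8 := dq (qone R) (pureq (const_mx (c i))).
pose x i (t : R) := dqmul (X i) (delta i).
have uX l : unit_dq (X l).
  apply/unit_dqP; rewrite /X prim_dq dual_dq /qdot !qoneE pureq0E; split; ring.
have xcenE l t : xcen delta x l t = X l.
  by rewrite /xcen /x -dqmulA hdelta dqmulq1.
have sol : is_solution a delta x.
  move=> l t t0; split.
  - exact: unit_dqM.
  - rewrite xcenE; split=> //; rewrite /X prim_dq qone0E => h.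
    by lra.
  - exact: derivable_cst.
  rewrite derive1_cst.
  have -> : \sum_(j < n) a l j *: vec6 (dqlog (xcen delta x l t) -
     dqlog (xcen delta x j t)) = 0.
    under eq_bigr do rewrite !xcenE.
    rewrite log_disagreementE; set u := (Y in col_mx Y _); set v := (Y in col_mx _ Y).
    have -> : u = 0.
      apply/colP => k; rewrite [LHS]mxE [RHS]mxE; apply: big1 => m _.
      by rewrite /X !prim_dq subrr mulr0.
    have -> : v = 0.
      apply/colP => k; rewrite [LHS]mxE [RHS]mxE -[RHS](harm l); apply: eq_bigr => m _.
      by rewrite !half_translE /X !prim_dq !dual_dq qconj1 !qmulq1 !qim_pureq !mxE.
    exact: (@col_mx0 R 3 3 1).
  by rewrite mulmx0 oppr0.
have [xc cvg] := form x sol.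
have XE l : X l = xc.
  have -> : X l = lim (xcen delta x l t @[t --> +oo]).
    by under eq_fun do rewrite xcenE; rewrite lim_cst.
  exact: cvg_lim.
apply: cij.
have : X i = X j by rewrite !XE.
by move=> /dq_inj[_] /colP/(_ 1); rewrite !pureqE !mxE.
Qed.

End Formation.

Theorem theorem10 (R : realType) (n : nat) (hn : (0 < n)%N)
  (a : 'I_n -> 'I_n -> R)
  (ha_nonneg : forall i j, 0 <= a i j) (ha_diag : forall i, a i i = 0)
  (delta : 'I_n -> 'cV[R]_8) (hdelta : forall i, unit_dq (delta i)) :
  achieves_formation a delta <-> has_spanning_tree a.
Proof.
split; first exact: formation_spanning_tree.
exact: spanning_tree_formation.
Qed.
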